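(* For all primes $p$ with $p\equiv 7$ or $11\pmod{12}$, all integers $n\geq 0$, and all $r\in\{1,\ldots,p-1\}$, we have $$\sum_{k=-\infty}^\infty (-1)^kB\left(3p^2n+3pr+\dfrac{5(p^2-1)}{4}+1-6k(3k+1)\right)\equiv 0\pmod{9}.$$
   Context: For $m\in\mathbb{N}$ and $|q|<1$ let $f_m:=\prod_{n\geq 1}(1-q^{mn})$. $B(n)$ denotes the number of partition triples $\pi=(\pi_1,\pi_2,\pi_3)$ of $n$ (the sum of all parts of $\pi_1,\pi_2,\pi_3$ is $n$; empty partitions are allowed) such that $\pi_1$ and $\pi_2$ each consist of distinct odd parts and $\pi_3$ consists of parts divisible by $4$. Equivalently, $\sum_{n=0}^\infty B(n)q^n=\dfrac{f_2^4}{f_1^2f_4^3}$. Convention: $B(m)=0$ for every negative integer $m$, so the sum over $k\in\mathbb{Z}$ has only finitely many nonzero terms. *)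

(* Defs.v *)
From mathcomp Require Import all_boot all_order all_algebra finmap.
From mathcomp Require Import boolp classical_sets functions cardinality fsbigop.
From mathcomp Require Import zify.

Set Implicit Arguments.
Unset Strict Implicit.
Unset Printing Implicit Defensive.

Import Order.TTheory GRing.Theory Num.Theory.

Local Open Scope classical_set_scope.

(* A partition is the non-increasing sequence of its (positive) parts. *)
Definition is_partition (s : seq nat) : bool := sorted geq s && (0 \notin s).

Definition distinct_odd_parts (s : seq nat) : bool := uniq s && all odd s.

Definition parts_divisible_by (d : nat) (s : seq nat) : bool :=
  all (dvdn d) s.

Definition partition_triples (n : nat) : set (seq nat * seq nat * seq nat) :=
  [set s | let: (s1, s2, s3) := s in
    [/\ [&& is_partition s1, is_partition s2 & is_partition s3],
        distinct_odd_parts s1,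
        distinct_odd_parts s2,
        parts_divisible_by 4 s3 &
        sumn s1 + sumn s2 + sumn s3 = n]].

Lemma finite_partitions_le (n : nat) :
  finite_set [set s | is_partition s /\ sumn s <= n].
Proof.
pose f (t : n.-bseq 'I_n.+1) : seq nat := map (@nat_of_ord _) t.
apply: (@sub_finite_set _ _ (f @` setT)); last exact/finite_image/finite_finset.
move=> s [/andP[_ s0] sn].
have sz : size s <= sumn s.
  elim: s s0 {sn} => //= x s IH; rewrite inE negb_or => /andP[x0 /IH].
  by rewrite -add1n; apply: leq_add; rewrite lt0n eq_sym.
have bd : all (fun x => x < n.+1) s.
  apply: sub_all (_ : all (fun x => x <= sumn s) s) => [x /leq_trans|].
    by rewrite ltnS; apply.
  elim: s {s0 sn sz} => //= x s IH; rewrite leq_addr /=.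
  by apply: sub_all IH => y /leq_trans; apply; rewrite leq_addl.
have sz' : size (map (@inord n) s) <= n by rewrite size_map (leq_trans sz).
exists (Bseq sz') => //; rewrite /f /= -map_comp -[RHS]map_id.
by apply/eq_in_map => x xs /=; rewrite inordK // (allP bd).
Qed.

Lemma finite_partition_triples (n : nat) : finite_set (partition_triples n).
Proof.
pose A := [set s | is_partition s /\ sumn s <= n].
have fA : finite_set A := finite_partitions_le n.
apply: (@sub_finite_set _ _ (A `*` A `*` A)); last by do 2?apply: finite_setX.
move=> [[s1 s2] s3] /= [/and3P[p1 p2 p3] _ _ _ En].
split; [split|]; split => //; rewrite -En ?leq_addl // -addnA ?leq_addr //.
by rewrite addnCA leq_addr.
Qed.

(* [fset_set] returns the junk value [fset0] on infinite sets only, and the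
   set of triples is finite by [finite_partition_triples]. *)
Definition nb_triples (n : nat) : nat := #|` fset_set (partition_triples n)|.

Local Open Scope ring_scope.

Definition B (m : int) : int :=
  match m with
  | Posz n => (nb_triples n)%:Z
  | Negz _ => 0
  end.

(* Sums of (-1)^k B(N - 6k(3k+1)) over all integers k are written with
   [\sum_(k \in [set: int])], whose terms must have finite support: a big sum
   over an infinite set is 0 by convention when its support is
   infinite; this lemma shows that this never occurs here. *)
Lemma finite_support_B (N : int) :
  finite_set ([set: int] `&`
    (fun k : int => (-1) ^ k * B (N - 6 * k * (3 * k + 1)))
      @^-1` [set~ 0]).
Proof.
pose f (i : 'I_(`|N|.+1) + 'I_(`|N|.+1)) : int :=
  match i with inl i => (i : nat)%:Z | inr i => (- (i : nat)%:Z)%R end.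
apply: (@sub_finite_set _ _ (f @` setT)); last exact/finite_image/finite_finset.
move=> k [_ /= kB].
have kN : (`|k| < `|N|.+1)%N.
  have Nk : (0 <= N - 6 * k * (3 * k + 1))%R.
    rewrite leNgt; apply/negP; case E : (_ - _)%R kB => [//|m].
    by rewrite /B mulr0.
  rewrite ltnS leqNgt; apply/negP => Nk'.
  move: Nk; rewrite subr_ge0 leNgt => /negP; apply.
  have NkZ : (`|N| < `|k|)%R by rewrite -!abszE ltz_nat.
  apply: (le_lt_trans (ler_norm N)); apply: (lt_le_trans NkZ).
  by clear; nia.
case: (lerP 0%R k) => k0.
  by exists (inl (Ordinal kN)) => //=; rewrite gez0_abs.
by exists (inr (Ordinal kN)) => //=; rewrite ltz0_abs // opprK.
Qed.

(* Main.v *)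
From HB Require Import structures.
Require Import Defs.
From mathcomp Require Import all_boot all_order all_algebra finmap.
From mathcomp Require Import boolp classical_sets functions cardinality fsbigop.
From mathcomp Require Import zify ring.

Set Implicit Arguments.
Unset Strict Implicit.
Unset Printing Implicit Defensive.

Import Order.TTheory GRing.Theory Num.Theory.

Local Open Scope classical_set_scope.
Local Open Scope ring_scope.

(** Write f_k for the product of the (1 - q^(kn)), S(q) for the sum of
    sigma(n) q^n, and psi(q) for the sum of q^(n(n+1)/2), n >= 0.

    By Euler's pentagonal number theorem at q^12, the sum over k is the
    coefficient of q^N in f_12 * sum_n B(n) q^n.  The product side of psi gives
    psi^2 = f_4^3 * sum_n B(n) q^n ([Bser_psi]), so this series is
    psi^2 f_12 / f_4^3.  From (1 - x^3) / (1 - x)^3 = 1 + 3x / (1 - x)^2 one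
    gets f_3 / f_1^3 = 1 + 3 S(q) modulo 9 ([euler3_mod9]), so modulo 9 the
    coefficient is that of psi^2 + 3 psi^2 S(q^4) ([Bser_mod9]).

    Here N = 3M + 1, and 4N + 1 = p (12pn + 12r + 5p) is divisible by p exactly
    once.  The coefficient of q^N in psi^2 counts the ways to write 2(4N + 1) as
    a sum of squares of two positive odd integers; it vanishes since p = 3 mod 4
    ([psi_sq_coef0]).  It remains to see that psi^2 S(q^4) has a coefficient
    divisible by 3 at q^N, which follows from the congruence
    2 [q^(3M+1)] psi^2 S(q^4) = M [q^(3M+1)] psi^2 modulo 3
    ([psi_sq_Sumdiv4]).

    That congruence is proved in characteristic 3 by splitting series according
    to the exponent modulo 3.  With A(q) the sum of q^n over generalized
    pentagonal numbers n, psi(q) = A(q^3) + q psi(q^9), whence, D = q d/dq being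
    a derivation, D psi = q psi^9.  Logarithmic derivatives of
    psi f_1 = f_2^2 and A f_2^2 = f_1^5 then give S(q) - S(q^2) = q psi^8
    ([Sumdiv_psi]) and DA = A (S(q) + S(q^2)) ([sder_pent]).  The first identity
    determines the part of S with exponents 1 mod 3, namely
    S = S(q^3) + q W(q^3) with W = A^2 psi^2 ([Sumdiv31_theta]), and Hecke's
    relation for sigma at the prime 2 gives
    S(q) + S(q^2) + S(q^4) = q psi(-q)^8 ([Sumdiv_sneg]).  Together they show
    that the part of psi^2 S(q^4) with exponents 1 mod 3 is q (D(A psi^3))(q^3),
    whereas that of psi^2 is 2q (A psi^3)(q^3).

    The product formulas for f_12, psi and A are cases of the Jacobi triple
    product ([jtp]), the limit of a finite identity with Gaussian binomial
    coefficients ([finite_jtp]). *)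

(** * Formal power series *)

(** A wrapper rather than [nat -> R] itself, which already carries the pointwise
    product. *)
Record series (R : Type) := Series { scoef :> nat -> R }.

Lemma seriesP (R : Type) (f g : series R) : f =1 g -> f = g.
Proof. by case: f g => f [g] /= /funext ->. Qed.

HB.instance Definition _ (R : Type) := gen_eqMixin (series R).
HB.instance Definition _ (R : Type) := gen_choiceMixin (series R).

Section SeriesZmod.
Variable R : zmodType.
Definition szero : series R := Series (fun=> 0).
Definition sopp (f : series R) := Series (fun n => - f n).
Definition sadd (f g : series R) := Series (fun n => f n + g n).
Fact saddA : associative sadd.
Proof. by move=> f g h; apply: seriesP => n /=; rewrite addrA. Qed.
Fact saddC : commutative sadd.
Proof. by move=> f g; apply: seriesP => n /=; rewrite addrC. Qed.
Fact sadd0 : left_id szero sadd.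
Proof. by move=> f; apply: seriesP => n /=; rewrite add0r. Qed.
Fact saddN : left_inverse szero sopp sadd.
Proof. by move=> f; apply: seriesP => n /=; rewrite addNr. Qed.
HB.instance Definition _ :=
  GRing.isZmodule.Build (series R) saddA saddC sadd0 saddN.

Lemma scoefD (f g : series R) n : (f + g) n = f n + g n. Proof. by []. Qed.
Lemma scoefN (f : series R) n : (- f) n = - f n. Proof. by []. Qed.
Lemma scoefB (f g : series R) n : (f - g) n = f n - g n. Proof. by []. Qed.
Lemma scoefMn (f : series R) m n : (f *+ m) n = f n *+ m.
Proof. by elim: m => [|m IH]; rewrite ?mulr0n // !mulrS scoefD IH. Qed.
Lemma scoef_sum I (r : seq I) P (F : I -> series R) n :
  (\sum_(i <- r | P i) F i) n = \sum_(i <- r | P i) F i n.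
Proof. by elim/big_rec2: _ => // i y f _ <-. Qed.
End SeriesZmod.

Section SeriesRing.
Variable R : comNzRingType.
Implicit Types f g h : series R.

Definition sone : series R := Series (fun n => (n == 0%N)%:R).
Definition smul f g : series R :=
  Series (fun n => \sum_(i < n.+1) f i * g (n - i)%N).

(** Truncations transport the ring axioms of polynomials to the convolution
    product: a coefficient depends on finitely many others. *)
Definition spoly n f : {poly R} := \poly_(i < n) f i.

Lemma smul_poly n m f g (p r : {poly R}) : (m <= n)%N ->
    (forall i, (i <= n)%N -> p`_i = f i) ->
    (forall i, (i <= n)%N -> r`_i = g i) ->
  (p * r)`_m = smul f g m.
Proof.
move=> mn pf rg; rewrite coefM; apply: eq_bigr => i _.
by rewrite pf ?rg // ?(leq_trans _ mn) // ?leq_subr // -ltnS.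
Qed.

Lemma coef_spoly n f i : (i <= n)%N -> (spoly n.+1 f)`_i = f i.
Proof. by move=> le; rewrite coef_poly ltnS le. Qed.

Lemma smulE n f g : smul f g n = (spoly n.+1 f * spoly n.+1 g)`_n.
Proof. by rewrite (@smul_poly n _ f g) // => i /coef_spoly ->. Qed.

Fact smulA : associative smul.
Proof.
move=> f g h; apply: seriesP => n.
rewrite -(@smul_poly n n f (smul g h) (spoly n.+1 f)
  (spoly n.+1 g * spoly n.+1 h)) //; first last.
- by move=> i le; apply: (@smul_poly n) => // j /coef_spoly.
- by move=> i /coef_spoly.
rewrite mulrA; apply: (@smul_poly n) => // i le; last exact: coef_spoly.
by apply: (@smul_poly n) => // j /coef_spoly.
Qed.

Fact smulC : commutative smul.
Proof. by move=> f g; apply: seriesP => n; rewrite !smulE mulrC. Qed.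

Fact smul1 : left_id sone smul.
Proof.
move=> f; apply: seriesP => n; rewrite /= big_ord_recl /= mul1r subn0.
by rewrite big1 ?addr0 // => i _; rewrite mul0r.
Qed.

Fact smulDl : left_distributive smul (+%R : series R -> series R -> series R).
Proof.
move=> f g h; apply: seriesP => n; rewrite /= -big_split /=.
by apply: eq_bigr => i _; rewrite mulrDl.
Qed.

Fact sone_neq0 : sone != 0 :> series R.
Proof.
by apply/eqP => /(congr1 (fun f : series R => f 0%N)) /eqP /=; rewrite oner_eq0.
Qed.

HB.instance Definition _ := GRing.Zmodule_isComNzRing.Build (series R)
  smulA smulC smul1 smulDl sone_neq0.

Lemma scoef1 n : (1 : series R) n = (n == 0%N)%:R. Proof. by []. Qed.
Lemma scoefM f g n : (f * g) n = \sum_(i < n.+1) f i * g (n - i)%N.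
Proof. by []. Qed.
Lemma scoefM0 f g : (f * g) 0%N = f 0%N * g 0%N.
Proof. by rewrite scoefM big_ord1. Qed.
Lemma scoef_nat m n : (m%:R : series R) n = (m * (n == 0))%N%:R.
Proof. by rewrite scoefMn scoef1 -mulrnA mulnC. Qed.
Lemma scoefMnat m f n : (m%:R * f) n = m%:R * f n.
Proof. by rewrite !mulr_natl scoefMn. Qed.

Definition qvar : series R := Series (fun n => (n == 1%N)%:R).

Lemma scoef_qvarM f n : (qvar * f) n = if n is n'.+1 then f n' else 0.
Proof.
case: n => [|n]; first by rewrite scoefM0 mul0r.
rewrite scoefM !big_ord_recl /= mul0r add0r mul1r subSS subn0.
by rewrite big1 ?addr0 // => i _; rewrite mul0r.
Qed.

Lemma scoef_qvarXM m f n :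
  (qvar ^+ m * f) n = if (m <= n)%N then f (n - m)%N else 0.
Proof.
elim: m f n => [|m IH] f n; first by rewrite mul1r subn0.
by rewrite exprS -mulrA scoef_qvarM; case: n => // n; rewrite IH.
Qed.

Lemma scoef_qvarX m n : (qvar ^+ m) n = (n == m)%:R.
Proof.
rewrite -[qvar ^+ m]mulr1 scoef_qvarXM scoef1 subn_eq0 eqn_leq.
by case: (leqP m n); rewrite ?andbT ?andbF.
Qed.

Definition eqmod n f g := forall i, (i < n)%N -> f i = g i.

Lemma eqmodM n f f' g g' :
  eqmod n f f' -> eqmod n g g' -> eqmod n (f * g) (f' * g').
Proof.
move=> ff gg i lin; rewrite !scoefM; apply: eq_bigr => j _.
have ji : (j <= i)%N by rewrite -ltnS.
by rewrite ff ?gg ?(leq_ltn_trans _ lin) ?leq_subr.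
Qed.

Lemma eqmod_sum n I (r : seq I) (P : pred I) (F G : I -> series R) :
    (forall i, P i -> eqmod n (F i) (G i)) ->
  eqmod n (\sum_(i <- r | P i) F i) (\sum_(i <- r | P i) G i).
Proof. by move=> FG j jn; rewrite !scoef_sum; apply: eq_bigr => i /FG ->. Qed.

(** A series with constant term 1 is cancellable modulo every q^n, so divisions
    by infinite products can be avoided. *)
Lemma eqmod_mulI n f g h : f 0%N = 1 ->
  eqmod n (f * g) (f * h) -> eqmod n g h.
Proof.
move=> f0 fgh; elim/ltn_ind=> i IH lin.
have := fgh i lin; rewrite !scoefM !big_ord_recl /= f0 !mul1r subn0.
rewrite (eq_bigr (fun j : 'I_i => f (bump 0 j) * h (i - bump 0 j)%N)).
  exact: addIr.
by move=> j _; rewrite IH // /bump /=; have := ltn_ord j; lia.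
Qed.

Lemma smulI f g h : f 0%N = 1 -> f * g = f * h -> g = h.
Proof.
move=> f0 fgh; apply: seriesP => n; apply: (@eqmod_mulI n.+1 f) => // i _.
by rewrite fgh.
Qed.

(** Convergence in the q-adic topology. *)
Definition slim (F : nat -> series R) f :=
  forall n, exists m0, forall m, (m0 <= m)%N -> eqmod n (F m) f.

Lemma slim_unique F f g : slim F f -> slim F g -> f = g.
Proof.
move=> Ff Fg; apply: seriesP => n.
have [[m1 h1] [m2 h2]] := (Ff n.+1, Fg n.+1).
by rewrite -(h1 (maxn m1 m2)) ?leq_maxl // (h2 (maxn m1 m2)) ?leq_maxr.
Qed.

Lemma slim_ext F G f : F =1 G -> slim F f -> slim G f.
Proof. by move=> /funext ->. Qed.

Lemma slim_cst f : slim (fun=> f) f.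
Proof. by move=> n; exists 0%N. Qed.

Lemma slimM F G f g : slim F f -> slim G g -> slim (fun m => F m * G m) (f * g).
Proof.
move=> Ff Gg n; have [[m1 h1] [m2 h2]] := (Ff n, Gg n).
exists (maxn m1 m2) => m; rewrite geq_max => /andP[/h1 ? /h2 ?].
exact: eqmodM.
Qed.

Lemma slim_prod d (F : 'I_d -> nat -> series R) (f : 'I_d -> series R) :
    (forall r, slim (F r) (f r)) ->
  slim (fun m => \prod_(r < d) F r m) (\prod_(r < d) f r).
Proof.
elim: d F f => [|d IH] F f Ff.
  by rewrite big_ord0; apply: slim_ext (slim_cst _) => m; rewrite big_ord0.
rewrite big_ord_recl; apply: slim_ext (slimM (Ff ord0) (IH _ _ _)) => [m|r].
  by rewrite big_ord_recl.
exact: Ff.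
Qed.

Lemma slimD F G f g : slim F f -> slim G g -> slim (fun m => F m + G m) (f + g).
Proof.
move=> Ff Gg n; have [[m1 h1] [m2 h2]] := (Ff n, Gg n).
exists (maxn m1 m2) => m; rewrite geq_max => /andP[/h1 e1 /h2 e2] i lin.
by rewrite !scoefD e1 ?e2.
Qed.

Lemma slim_mulnl F f d : (0 < d)%N -> slim F f -> slim (fun m => F (d * m)%N) f.
Proof.
move=> d0 Ff n; have [m0 h] := Ff n; exists m0 => m lem; apply: h.
by rewrite (leq_trans lem) // leq_pmull.
Qed.

(** The derivation q d/dq. *)
Definition sder f : series R := Series (fun n => n%:R * f n).

Lemma sderM f g : sder (f * g) = sder f * g + f * sder g.
Proof.
apply: seriesP => n /=; rewrite mulr_sumr -big_split; apply: eq_bigr => i _ /=.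
have -> : n%:R = i%:R + (n - i)%:R :> R by rewrite -natrD subnKC // -ltnS.
ring.
Qed.

Lemma sderD f g : sder (f + g) = sder f + sder g.
Proof. by apply: seriesP => n /=; rewrite mulrDr. Qed.
Lemma sderN f : sder (- f) = - sder f.
Proof. by apply: seriesP => n /=; rewrite mulrN. Qed.
Lemma sder1 : sder 1 = 0.
Proof. by apply: seriesP => -[|n] /=; rewrite ?mul0r ?mulr0. Qed.
Lemma sderX f m : sder (f ^+ m) = m%:R * f ^+ m.-1 * sder f.
Proof.
elim: m => [|m IH]; first by rewrite sder1 !mul0r.
rewrite exprS sderM IH /= mulrS; case: m {IH} => [|m] /=.
  by rewrite expr0; ring.
rewrite exprS; ring.
Qed.
Lemma sder_qvar : sder qvar = qvar.
Proof. by apply: seriesP => -[|[|n]] /=; rewrite ?mul0r ?mulr1 ?mulr0. Qed.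

Lemma slim_der F f : slim F f -> slim (fun m => sder (F m)) (sder f).
Proof.
by move=> Ff n; have [m0 h] := Ff n; exists m0 => m /h e i /e /= ->.
Qed.

(** The substitution of -q for q. *)
Definition sneg f : series R := Series (fun n => (-1) ^+ n * f n).

Lemma snegM f g : sneg (f * g) = sneg f * sneg g.
Proof.
apply: seriesP => n /=; rewrite mulr_sumr; apply: eq_bigr => i _.
have -> : (-1) ^+ n = (-1) ^+ i * (-1) ^+ (n - i) :> R.
  by rewrite -exprD subnKC // -ltnS.
ring.
Qed.
Fact sneg_zmod_morphism : zmod_morphism sneg.
Proof. by move=> f g; apply: seriesP => n /=; rewrite mulrBr. Qed.
Fact sneg_monoid_morphism : monoid_morphism sneg.
Proof.
split; last exact: snegM.
by apply: seriesP => -[|n] /=; rewrite ?mulr0 ?mulr1.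
Qed.
HB.instance Definition _ :=
  GRing.isZmodMorphism.Build (series R) (series R) sneg sneg_zmod_morphism.
HB.instance Definition _ :=
  GRing.isMonoidMorphism.Build (series R) (series R) sneg sneg_monoid_morphism.

Lemma sneg_qvar : sneg qvar = - qvar.
Proof.
by apply: seriesP => -[|[|n]] /=; rewrite ?mulr0 ?mulr1 ?oppr0.
Qed.

Lemma slim_neg F f : slim F f -> slim (fun m => sneg (F m)) (sneg f).
Proof.
by move=> Ff n; have [m0 h] := Ff n; exists m0 => m /h e i /e /= ->.
Qed.

(** The substitution of q^k for q; at k = 0 it is evaluation at q = 0, so it is a
    ring morphism for every k. *)
Definition sdil k f : series R :=
  Series (fun n => if (k %| n)%N then f (n %/ k)%N else 0).

Lemma sdil_poly k n f i : (0 < k)%N -> (i <= n)%N ->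
  (spoly n.+1 f \Po 'X^k)`_i = sdil k f i.
Proof.
move=> k0 le; rewrite coef_comp_poly_Xn //=; case: ifP => // dv.
by rewrite coef_spoly // (leq_trans _ le) // leq_div.
Qed.

Lemma sdilM k f g : sdil k (f * g) = sdil k f * sdil k g.
Proof.
apply: seriesP => n; have [->|k0] := posnP k.
  have dil0 h i : sdil 0 h i = if i == 0%N then h 0%N else 0.
    by rewrite /= dvd0n divn0.
  rewrite dil0 scoefM0 scoefM big_ord_recl big1 => [|i _]; last first.
    by rewrite dil0 mul0r.
  by rewrite addr0 !dil0 subn0; case: eqP; rewrite ?mulr0.
rewrite -(@sdil_poly k n) // scoefM.
rewrite -[RHS](@smul_poly n n _ _ (spoly n.+1 f \Po 'X^k)
  (spoly n.+1 g \Po 'X^k)) //; last 2 first.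
- by move=> i; exact: sdil_poly.
- by move=> i; exact: sdil_poly.
rewrite -comp_polyM !coef_comp_poly_Xn //; case: ifP => // _.
have le : (n %/ k <= n)%N by rewrite leq_div.
by rewrite coef_spoly // -(@smul_poly n _ f g (spoly n.+1 f) (spoly n.+1 g)) //;
  move=> i /coef_spoly.
Qed.
Fact sdil_zmod_morphism k : zmod_morphism (sdil k).
Proof.
by move=> f g; apply: seriesP => n /=; case: ifP => _; rewrite ?subr0.
Qed.
Fact sdil_monoid_morphism k : monoid_morphism (sdil k).
Proof.
split; last exact: sdilM.
apply: seriesP => n /=; have [/dvdnP[m ->]|] := ifPn.
  by case: k => [|k]; rewrite ?muln0 // mulnK // muln_eq0 orbF.
by case: n => //; rewrite dvdn0.
Qed.
HB.instance Definition _ k := GRing.isZmodMorphism.Build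
  (series R) (series R) (sdil k) (@sdil_zmod_morphism k).
HB.instance Definition _ k := GRing.isMonoidMorphism.Build
  (series R) (series R) (sdil k) (@sdil_monoid_morphism k).

Lemma scoef_dil0 k f : sdil k f 0%N = f 0%N.
Proof. by rewrite /= dvdn0 div0n. Qed.

Lemma sdil_qvar k : (0 < k)%N -> sdil k qvar = qvar ^+ k.
Proof.
move=> k0; apply: seriesP => n; rewrite scoef_qvarX /=.
case: ifP => [/dvdnP[m ->]|/negP dv].
  by rewrite mulnK //; congr (_%:R); nia.
by case: eqP => // nk; case: dv; rewrite nk.
Qed.

Lemma sdil_comp k l f : (0 < k)%N -> (0 < l)%N ->
  sdil k (sdil l f) = sdil (k * l) f.
Proof.
move=> k0 l0; apply: seriesP => n /=.
case: (boolP (k %| n)%N) => [/dvdnP[a ->]|dv].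
  by rewrite mulnK // [(a * _)%N]mulnC dvdn_pmul2l // divnMl.
case: ifP => // dv'; case/negP: dv; exact: dvdn_trans (dvdn_mulr _ _) dv'.
Qed.

Lemma sder_dil k f : sder (sdil k f) = k%:R * sdil k (sder f).
Proof.
apply: seriesP => n; rewrite scoefMnat /=.
case: ifP => [/dvdnP[m ->]|]; rewrite ?mulr0 //.
case: k => [|k]; first by rewrite muln0 !mul0r.
by rewrite mulnK // mulnC natrM mulrA.
Qed.

Lemma slim_dil k F f : slim F f -> slim (fun m => sdil k (F m)) (sdil k f).
Proof.
move=> Ff n; have [m0 h] := Ff n; exists m0 => m /h e i lin /=.
by case: ifP => // _; apply: e; rewrite (leq_ltn_trans _ lin) // leq_div.
Qed.

(** * Infinite products *)

(** The coefficient of q^n no longer changes after n + 1 factors, provided that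
    the i-th factor is 1 modulo q^(i+1). *)
Definition iprod (F : nat -> series R) : series R :=
  Series (fun n => (\prod_(i < n.+1) F i) n).

Lemma eqmod_iprod F n m : (forall i, eqmod i.+1 (F i) 1) -> (n <= m)%N ->
  eqmod n (\prod_(i < m) F i) (iprod F).
Proof.
move=> F1 nm i lin; have {nm lin} : (i < m)%N by exact: leq_trans nm.
elim: m => // m IH; rewrite ltnS leq_eqVlt => /orP[/eqP -> //|im].
rewrite -IH // big_ord_recr /= -[RHS](congr1 (fun f : series R => f i) (mulr1 _)).
by apply: (@eqmodM m.+1) => //; rewrite ltnS ltnW.
Qed.

Lemma slim_iprod F : (forall i, eqmod i.+1 (F i) 1) ->
  slim (fun m => \prod_(i < m) F i) (iprod F).
Proof. by move=> F1 n; exists n => m; exact: eqmod_iprod. Qed.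

Definition qterm (c : series R) a b i : series R := 1 + c * qvar ^+ (a * i + b).
(** The q-Pochhammer symbol (-c q^b; q^a). *)
Definition qfac (c : series R) a b := iprod (qterm c a b).

Lemma qterm_eqmod c a b i : (0 < a)%N -> (0 < b)%N ->
  eqmod i.+1 (qterm c a b i) 1.
Proof.
move=> a0 b0 j lej; rewrite /qterm scoefD mulrC scoef_qvarXM.
by rewrite leqNgt ifF ?addr0 //; nia.
Qed.

Lemma slim_qfac c a b : (0 < a)%N -> (0 < b)%N ->
  slim (fun m => \prod_(i < m) qterm c a b i) (qfac c a b).
Proof. by move=> a0 b0; apply: slim_iprod => i; exact: qterm_eqmod. Qed.

Lemma qfac0 c a b : (0 < a)%N -> (0 < b)%N -> (qfac c a b) 0%N = 1.
Proof.
by move=> a0 b0; rewrite /= big_ord1 (@qterm_eqmod c a b 0).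
Qed.

(** The factors are sorted by their index modulo d. *)
Lemma qfac_split d c a b : (0 < d)%N -> (0 < a)%N -> (0 < b)%N ->
  qfac c a b = \prod_(r < d) qfac c (d * a) (a * r + b).
Proof.
move=> d0 a0 b0; apply: slim_unique (slim_mulnl d0 (slim_qfac c a0 b0)) _.
apply: (@slim_ext (fun m =>
    \prod_(r < d) \prod_(i < m) qterm c (d * a) (a * r + b) i)).
  move=> m; rewrite exchange_big /=.
  elim: m => [|m IH]; first by rewrite muln0 !big_ord0.
  rewrite big_ord_recr /= {}IH mulnS addnC -[in RHS](big_mkord xpredT).
  rewrite (@big_cat_nat _ _ _ (d * m)%N) ?leq_addr //= big_mkord; congr (_ * _).
  rewrite -{1}[(d * m)%N]addn0 [(d * m + 0)%N]addnC big_addn addKn big_mkord.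
  by apply: eq_bigr => i _; rewrite /qterm; congr (1 + c * _ ^+ _); lia.
by apply: slim_prod => r; apply: slim_qfac; lia.
Qed.

End SeriesRing.

(** * Jacobi's triple product *)

Section Gauss.
Variables (R : comNzRingType) (Q : R).

Fixpoint qbinom n j : R :=
  match n, j with
  | _, 0%N => 1
  | 0%N, _.+1 => 0
  | n'.+1, j'.+1 => qbinom n' j'.+1 + Q ^+ (n' - j') * qbinom n' j'
  end.

Lemma qbinom0 n : qbinom n 0 = 1. Proof. by case: n. Qed.
Lemma qbinomS n j : qbinom n.+1 j.+1 = qbinom n j.+1 + Q ^+ (n - j) * qbinom n j.
Proof. by []. Qed.

Lemma qbinom_small n j : (n < j)%N -> qbinom n j = 0.
Proof.
elim: n j => [|n IH] [|j] //; rewrite ltnS => nj.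
by rewrite qbinomS !IH // ?mulr0 ?addr0 // ltnW.
Qed.

(** The other Pascal rule.  The finite triple product uses the two rules in
    turn. *)
Lemma qbinomS' n j : qbinom n.+1 j.+1 = qbinom n j + Q ^+ j.+1 * qbinom n j.+1.
Proof.
elim: n j => [|n IH] [|j] //.
- by rewrite /= subn0 expr0; ring.
- by rewrite /=; ring.
- rewrite qbinomS {1}IH [in RHS]qbinomS !qbinom0 !subn0 !mulr1 !expr1 exprS; ring.
have [jn|nj] := leqP j.+1 n; last first.
  rewrite qbinomS [qbinom n.+1 j.+2]qbinom_small // mulr0 addr0 add0r.
  by rewrite (_ : (n.+1 - j.+1)%N = 0%N) ?expr0 ?mul1r //; lia.
rewrite qbinomS {1}(IH j.+1) {1}(IH j) [qbinom n.+1 j.+2]qbinomS [qbinom n.+1 j.+1]qbinomS subSS.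
rewrite (_ : (n - j)%N = (n - j.+1).+1); last by lia.
rewrite !exprS; ring.
Qed.

Arguments qbinom : simpl never.

Definition qpoch r : R := \prod_(i < r) (1 - Q ^+ i.+1).

Lemma qpochS r : qpoch r.+1 = qpoch r * (1 - Q ^+ r.+1).
Proof. by rewrite /qpoch big_ord_recr. Qed.

Lemma qbinom_qpoch n j : (j <= n)%N ->
  qbinom n j * qpoch j * qpoch (n - j) = qpoch n.
Proof.
elim: n j => [|n IH] [|j] // jn; rewrite ?qbinom0 ?subn0.
- by rewrite /qpoch big_ord0 !mul1r.
- by rewrite /qpoch big_ord0 !mul1r.
rewrite subSS qbinomS; have [->|nj] := eqVneq j n.
  rewrite qbinom_small // subnn expr0 mul1r add0r.
  have := IH n (leqnn n); rewrite subnn qpochS => e.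
  by rewrite mulrA mulrAC e.
have lt : (j < n)%N by rewrite ltn_neqAle nj.
have e : (n - j)%N = (n - j.+1).+1 by lia.
have := IH _ lt; have := IH j (ltnW lt); rewrite e !qpochS -e => e1 e2.
transitivity ((qbinom n j.+1 * (qpoch j * (1 - Q ^+ j.+1)) * qpoch (n - j.+1)) *
   (1 - Q ^+ (n - j)) + Q ^+ (n - j) * (1 - Q ^+ j.+1) *
   (qbinom n j * qpoch j * (qpoch (n - j.+1) * (1 - Q ^+ (n - j))))); first by ring.
rewrite e1 e2 (_ : n.+1 = (n - j) + j.+1)%N ?exprD; last by lia.
ring.
Qed.
End Gauss.
Arguments qbinom : simpl never.

(** Triangular numbers of integer index: [tri k] and [tri (k - 1)] are the
    exponents k(k+1)/2 and k(k-1)/2 of Ramanujan's theta function, both natural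
    numbers for k of any sign. *)
Definition tri (k : int) : nat := (absz (k * (k + 1))%R %/ 2)%N.

Lemma tri_double k : (tri k)%:Z * 2 = k * (k + 1).
Proof.
have [m [->|->]] : exists m : nat, k = m%:Z \/ k = - (m.+1)%:Z.
  by case: k => m; exists m; [left|right; rewrite NegzE].
  rewrite /tri (_ : absz (m%:Z * (m%:Z + 1)) = (m * m.+1)%N); last by lia.
  have : (2 %| m * m.+1)%N by rewrite dvdn2 oddM /= andbN.
  by case/dvdnP=> e ee; rewrite ee mulnK //; lia.
rewrite /tri (_ : absz (- m.+1%:Z * (- m.+1%:Z + 1)) = (m * m.+1)%N); last by lia.
have : (2 %| m * m.+1)%N by rewrite dvdn2 oddM /= andbN.
by case/dvdnP=> e ee; rewrite ee mulnK //; lia.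
Qed.

Lemma triS k : (tri (k + 1))%:Z = (tri k)%:Z + k + 1.
Proof. by have := tri_double k; have := tri_double (k + 1); nia. Qed.

Section FiniteJTP.
Variables (R : comNzRingType) (x y : R).
Let Q := x * y.
Definition theta_term k : R := x ^+ tri k * y ^+ tri (k - 1).

Let aux1 (m j a b : nat) (k : int) : (j <= 2 * m)%N -> k = j%:Z - m%:Z ->
  b%:Z = a%:Z + k + 1 -> (1 + m + a = 2 * m - j + b)%N.
Proof. by move=> *; lia. Qed.
Let aux2 (m j a b : nat) (k : int) : (j <= 2 * m)%N -> k = j%:Z - m%:Z ->
  b%:Z = a%:Z + (k - 1) + 1 -> (m + a = 2 * m - j + b)%N.
Proof. by move=> *; lia. Qed.
Let aux3 (m j a b : nat) (k : int) : k = j%:Z - m.+1%:Z ->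
  b%:Z = a%:Z + k + 1 -> (m + b = j + a)%N.
Proof. by move=> *; lia. Qed.
Let aux4 (m j a b : nat) (k : int) : k = j%:Z - m.+1%:Z ->
  b%:Z = a%:Z + (k - 1) + 1 -> (1 + m + b = j + a)%N.
Proof. by move=> *; lia. Qed.

Let theta_term_x m j : (j <= 2 * m)%N ->
  x * Q ^+ m * theta_term (j%:Z - m%:Z) =
    Q ^+ (2 * m - j) * theta_term (j.+1%:Z - m%:Z).
Proof.
move=> jm; rewrite /theta_term /Q !exprMn.
set k : int := j%:Z - m%:Z; have -> : j.+1%:Z - m%:Z = k + 1 by rewrite /k; lia.
have ek : k = j%:Z - m%:Z by [].
have e1 := triS k; have e2 := triS (k - 1); rewrite subrK in e2.
have -> : k + 1 - 1 = k by rewrite addrK.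
transitivity (x ^+ (1 + m + tri k) * y ^+ (m + tri (k - 1)%R)).
  by rewrite !exprD; ring.
rewrite (_ : 1 + m + tri k = (2 * m - j) + tri (k + 1)%R)%N; last exact: (aux1 jm ek e1).
rewrite (_ : m + tri (k - 1)%R = (2 * m - j) + tri k)%N; last exact: (aux2 jm ek e2).
by rewrite !exprD; ring.
Qed.

Let theta_term_y m j :
  y * Q ^+ m * theta_term (j%:Z - m%:Z) = Q ^+ j * theta_term (j%:Z - m.+1%:Z).
Proof.
rewrite /theta_term /Q !exprMn.
set k : int := j%:Z - m.+1%:Z; have -> : j%:Z - m%:Z = k + 1 by rewrite /k; lia.
have ek : k = j%:Z - m.+1%:Z by [].
have e1 := triS k; have e2 := triS (k - 1); rewrite subrK in e2.
have -> : k + 1 - 1 = k by rewrite addrK.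
transitivity (x ^+ (m + tri (k + 1)%R) * y ^+ (1 + m + tri k)).
  by rewrite !exprD; ring.
rewrite (_ : m + tri (k + 1)%R = j + tri k)%N; last exact: (aux3 ek e1).
rewrite (_ : 1 + m + tri k = j + tri (k - 1)%R)%N; last exact: (aux4 ek e2).
by rewrite !exprD; ring.
Qed.

(** Multiplying by 1 + x Q^m, then by 1 + y Q^m, turns the row 2m of Gaussian
    binomials into the rows 2m + 1 and 2m + 2, by one Pascal rule each.  Writing
    the general term with x and y, where x y = Q, keeps all the exponents
    nonnegative. *)
Lemma finite_jtp m :
  \prod_(i < m) ((1 + x * Q ^+ i) * (1 + y * Q ^+ i)) =
  \sum_(j < (2 * m).+1) qbinom Q (2 * m) j * theta_term (j%:Z - m%:Z).
Proof.
elim: m => [|m IH]; first by rewrite big_ord0 big_ord1 /= mul1r /theta_term !mul1r.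
have step1 : (\prod_(i < m) ((1 + x * Q ^+ i) * (1 + y * Q ^+ i))) *
      (1 + x * Q ^+ m) =
    \sum_(j < (2 * m).+2) qbinom Q (2 * m).+1 j * theta_term (j%:Z - m%:Z).
  rewrite IH mulrDr mulr1 [RHS]big_ord_recl qbinom0 mul1r.
  under [X in _ = _ + X]eq_bigr => j _ do
    rewrite lift0 qbinomS mulrDl.
  rewrite big_split /= addrA; congr (_ + _).
    rewrite big_ord_recl qbinom0 mul1r; congr (_ + _).
    by rewrite big_ord_recr /= qbinom_small // mul0r addr0.
  rewrite mulr_suml; apply: eq_bigr => j _.
  have jm : (j <= 2 * m)%N by rewrite -ltnS.
  transitivity (qbinom Q (2 * m) j * (x * Q ^+ m * theta_term (j%:Z - m%:Z))).
    by ring.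
  by rewrite theta_term_x //; ring.
rewrite big_ord_recr /= [X in _ * X]mulrC mulrA mulrAC step1.
rewrite (_ : (2 * m.+1)%N = (2 * m).+2); last by lia.
rewrite mulrDr mulr1 [RHS]big_ord_recl qbinom0 mul1r.
under [X in _ = _ + X]eq_bigr => j _.
  rewrite lift0 qbinomS' mulrDl.
  rewrite (_ : j.+1%:Z - m.+1%:Z = j%:Z - m%:Z); last by lia.
  over.
rewrite big_split /= addrCA; congr (_ + _).
rewrite [in RHS]big_ord_recr /= qbinom_small // mulr0 mul0r addr0.
rewrite mulr_suml big_ord_recl qbinom0 !mul1r mulrC theta_term_y expr0 mul1r.
congr (_ + _); apply: eq_bigr => j _.
rewrite lift0; set u := qbinom _ _ _.
transitivity (u * (y * Q ^+ m * theta_term (j.+1%:Z - m%:Z))); first by ring.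
rewrite theta_term_y (_ : j.+1%:Z - m.+1%:Z = j%:Z - m%:Z); last by lia.
ring.
Qed.
End FiniteJTP.

Section JTP.
Variable R : comNzRingType.
Implicit Types c f g : series R.
Local Notation q := (qvar R).

Lemma slim_eqmod (F G : nat -> series R) f : slim F f ->
    (forall n, exists m0, forall m, (m0 <= m)%N -> eqmod n (G m) (F m)) ->
  slim G f.
Proof.
move=> Ff FG n; have [[m1 h1] [m2 h2]] := (Ff n, FG n).
exists (maxn m1 m2) => m; rewrite geq_max => /andP[/h1 e1 /h2 e2] i lin.
by rewrite e2 ?e1.
Qed.

Lemma tri_sum k : (tri k + tri (k - 1)%R = absz k * absz k)%N.
Proof.
have := tri_double k; have := triS (k - 1); rewrite subrK.
move: (tri k) (tri (k - 1)) => a b; nia.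
Qed.

(** Let m grow in [finite_jtp] with x = c q^a and y = c q^b.  Modulo q^n, a term
    with |k| >= n vanishes, and when |k| < n the Gaussian binomial coefficient
    agrees with the inverse of the infinite product of the 1 - Q^i, since it is a
    quotient of partial products with at least n factors. *)
Lemma jtp c a b : c * c = 1 -> (0 < a)%N -> (0 < b)%N ->
  slim (fun m => \sum_(j < (2 * m).+1)
                   theta_term (c * q ^+ a) (c * q ^+ b) (j%:Z - m%:Z))
       (qfac c (a + b) a * qfac c (a + b) b * qfac (-1) (a + b) (a + b)).
Proof.
move=> cc a0 b0; set x := c * q ^+ a; set y := c * q ^+ b.
have ab0 : (0 < a + b)%N by rewrite addn_gt0 a0.
set E := qfac (-1) _ _.
have Qe : x * y = q ^+ (a + b).
  by rewrite /x /y exprD mulrACA cc mul1r.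
apply: slim_eqmod (slimM (slimM (slim_qfac c ab0 a0) (slim_qfac c ab0 b0))
   (slim_cst E)) _ => n.
exists (2 * n)%N => m lem.
rewrite -big_split /=.
have -> : \prod_(i < m) (qterm c (a + b) a i * qterm c (a + b) b i) =
    \prod_(i < m) ((1 + x * (x * y) ^+ i) * (1 + y * (x * y) ^+ i)).
  apply: eq_bigr => i _; rewrite Qe /qterm /x /y -exprM !exprD; ring.
rewrite finite_jtp mulr_suml; apply: eqmod_sum => j _.
have qpochE r : (n <= r)%N -> eqmod n (qpoch (x * y) r) E.
  move=> nr; have -> : qpoch (x * y) r = \prod_(i < r) qterm (-1) (a + b) (a + b) i.
    by apply: eq_bigr => i _; rewrite Qe /qterm -exprM mulN1r mulnS addnC.
  by apply: eqmod_iprod => // i; exact: qterm_eqmod.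
set k := j%:Z - m%:Z.
have jm : (j <= 2 * m)%N by rewrite -ltnS.
have [kn|nk] := leqP n (absz k).
  have t0 h : eqmod n (h * theta_term x y k) 0.
    have -> : h * theta_term x y k = q ^+ (a * tri k + b * tri (k - 1)%R) *
        (h * (c ^+ tri k * c ^+ tri (k - 1))).
      by rewrite /theta_term /x /y !exprMn -!exprM exprD; ring.
    move=> i lin; rewrite scoef_qvarXM leqNgt ifF //.
    by apply/negbTE; rewrite negbK; have := tri_sum k; nia.
  move=> i lin; have := t0 1 i lin; rewrite mul1r => ->.
  by rewrite mulrAC t0.
apply: (@eqmod_mulI _ _ E); first exact: qfac0.
have h1 : (n <= j)%N by lia.
have h2 : (n <= 2 * m - j)%N by lia.
have e := qbinom_qpoch (x * y) jm.
rewrite (_ : E * (qbinom (x * y) (2 * m) j * theta_term x y k * E) =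
   (qbinom (x * y) (2 * m) j * E * E) * theta_term x y k); last by ring.
apply: eqmodM => //.
have ee : eqmod n (qbinom (x * y) (2 * m) j * qpoch (x * y) j *
    qpoch (x * y) (2 * m - j)) (qbinom (x * y) (2 * m) j * E * E).
  apply: eqmodM; last exact: qpochE.
  by apply: eqmodM => //; exact: qpochE.
by move=> i lin; rewrite -(ee i lin) e (qpochE (2 * m)%N _ i lin) //; lia.
Qed.

Lemma scoef_sum_qvarX (N : nat) (e : 'I_N -> nat) n : injective e ->
  (\sum_(j < N) q ^+ e j) n = ([exists j, e j == n])%:R.
Proof.
move=> inj; rewrite scoef_sum; case: existsP => [[j /eqP ej]|no].
  rewrite (bigD1 j) //= big1 ?addr0 => [|i ij]; rewrite scoef_qvarX -ej ?eqxx //.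
  by rewrite (inj_eq inj) eq_sym (negbTE ij).
rewrite big1 // => j _; rewrite scoef_qvarX; case: eqP => // ej.
by case: no; exists j; rewrite ej.
Qed.

Definition is_square n := [exists i : 'I_n.+1, (i * i)%N == n].

Lemma is_squareP n : reflect (exists i : nat, (i * i)%N = n) (is_square n).
Proof.
apply: (iffP existsP) => [[i /eqP <-]|[i ii]]; first by exists i.
have lt : (i < n.+1)%N by nia.
by exists (Ordinal lt); apply/eqP.
Qed.

(** When the exponents are pairwise distinct, the theta function is the indicator
    series of the set of its exponents. *)
Lemma theta_coef a b (P : pred nat) (t : series R) : (0 < a)%N -> (0 < b)%N ->
    (forall n, P n <-> exists k, (a * tri k + b * tri (k - 1)%R)%N = n) ->
    injective (fun k => a * tri k + b * tri (k - 1)%R)%N ->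
  slim (fun m => \sum_(j < (2 * m).+1)
           theta_term (1 * q ^+ a) (1 * q ^+ b) (j%:Z - m%:Z)) t ->
  forall n, t n = (P n)%:R.
Proof.
move=> a0 b0 Pn inj lt n; have [m0 h] := lt n.+1.
pose m := maxn m0 n; have mE : m = maxn m0 n by [].
rewrite -(h m) ?leq_maxl //; set e := fun k : int => _ in inj.
rewrite (eq_bigr (fun j : 'I_(2 * m).+1 => q ^+ e (j%:Z - m%:Z))) => [|j _].
  rewrite scoef_sum_qvarX => [|i j /inj]; last by move/addIr => [] /ord_inj.
  congr (nat_of_bool _)%:R; apply/existsP/idP => [[j /eqP ej]|/Pn[k ek]].
    by apply/Pn; exists (j%:Z - m%:Z).
  have km : (absz k <= m)%N.
    rewrite leq_max; apply/orP; right.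
    have := tri_sum k; rewrite -ek /e; nia.
  have lt' : (absz (k + m%:Z)%R < (2 * m).+1)%N by lia.
  exists (Ordinal lt'); apply/eqP; rewrite -[RHS]ek /=; congr (e _); lia.
by rewrite /theta_term !mul1r -!exprM -exprD.
Qed.

(** Triangular numbers are the n such that 8n + 1 is a square. *)
Definition psi : series R := Series (fun n => (is_square (8 * n).+1)%:R).
(** Generalized pentagonal numbers are the n such that 24n + 1 is a square. *)
Definition pent : series R := Series (fun n => (is_square (24 * n).+1)%:R).

(** The exponents 2k^2 - k, k an integer, are the triangular numbers, because
    8 (2k^2 - k) + 1 = (4k - 1)^2. *)
Lemma psi_prod : psi = qfac 1 4 1 * qfac 1 4 3 * qfac (-1) 4 4.
Proof.
have := @jtp 1 1 3 (mulr1 1) isT isT; rewrite -[(1 + 3)%N]/4%N => lt.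
apply: seriesP => n /=; apply/esym.
apply: (@theta_coef 1 3 (fun n => is_square (8 * n).+1)) lt n => //.
  move=> n; split=> [/is_squareP[i ei]|[k <-]].
    (* i = |4k - 1|, so that the residue of i modulo 4 fixes the sign of k *)
    exists (if (i %% 4 == 1)%N then - (i %/ 4)%N%:Z else ((i %/ 4).+1)%:Z).
    have ai : (i %% 4 = 1 \/ i %% 4 = 3)%N.
      have := divn_eq i 4; have : (i %% 4 < 4)%N by rewrite ltn_mod.
      move: (i %% 4)%N (i %/ 4)%N => r d; nia.
    have di := divn_eq i 4; move: di ai; set d := (i %/ 4)%N; set r := (i %% 4)%N.
    move=> di [] rr; rewrite rr /= in di *.
      have := tri_double (- d%:Z); have := triS (- d%:Z - 1); rewrite subrK.
      move: (tri _) (tri _) => u v; nia.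
    have := tri_double d.+1%:Z; have := triS (d.+1%:Z - 1); rewrite subrK.
    move: (tri _) (tri _) => u v; nia.
  apply/is_squareP; exists (absz (4 * k - 1)%R).
  have := tri_double k; have := triS (k - 1); rewrite subrK.
  move: (tri _) (tri _) => u v; nia.
move=> k l; have := tri_double k; have := triS (k - 1); rewrite subrK.
have := tri_double l; have := triS (l - 1); rewrite subrK.
move: (tri _) (tri _) (tri _) (tri _) => u v u' v' e1 e2 e3 e4 e.
have : (k - l) * (2 * (k + l) - 1) = 0 by nia.
by move/eqP; rewrite mulf_eq0 => /orP[] /eqP; lia.
Qed.

(** The exponents are (3k^2 - k)/2, and 12 (3k^2 - k) + 1 = (6k - 1)^2. *)
Lemma pent_prod : pent = qfac 1 3 1 * qfac 1 3 2 * qfac (-1) 3 3.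
Proof.
have := @jtp 1 1 2 (mulr1 1) isT isT; rewrite -[(1 + 2)%N]/3%N => lt.
apply: seriesP => n /=; apply/esym.
apply: (@theta_coef 1 2 (fun n => is_square (24 * n).+1)) lt n => //.
  move=> n; split=> [/is_squareP[i ei]|[k <-]].
    exists (if (i %% 6 == 1)%N then - (i %/ 6)%N%:Z else ((i %/ 6).+1)%:Z).
    have ai : (i %% 6 = 1 \/ i %% 6 = 5)%N.
      have := divn_eq i 6; have : (i %% 6 < 6)%N by rewrite ltn_mod.
      move: (i %% 6)%N (i %/ 6)%N => r d lt6 di.
      have : (r = 0 \/ r = 1 \/ r = 2 \/ r = 3 \/ r = 4 \/ r = 5)%N by lia.
      by move=> [|[|[|[|[]]]]] rr; subst r; [exfalso|left| exfalso|exfalso|exfalso|right]; nia.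
    have di := divn_eq i 6; move: di ai; set d := (i %/ 6)%N; set r := (i %% 6)%N.
    move=> di [] rr; rewrite rr /= in di *.
      have := tri_double (- d%:Z); have := triS (- d%:Z - 1); rewrite subrK.
      move: (tri _) (tri _) => u v; nia.
    have := tri_double d.+1%:Z; have := triS (d.+1%:Z - 1); rewrite subrK.
    move: (tri _) (tri _) => u v; nia.
  apply/is_squareP; exists (absz (6 * k - 1)%R).
  have := tri_double k; have := triS (k - 1); rewrite subrK.
  move: (tri _) (tri _) => u v; nia.
move=> k l; have := tri_double k; have := triS (k - 1); rewrite subrK.
have := tri_double l; have := triS (l - 1); rewrite subrK.
move: (tri _) (tri _) (tri _) (tri _) => u v u' v' e1 e2 e3 e4 e.
have : (k - l) * (3 * (k + l) - 1) = 0 by nia.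
by move/eqP; rewrite mulf_eq0 => /orP[] /eqP; lia.
Qed.

End JTP.

(** * Product identities and divisor sums *)

Section Eta.
Variable R : comNzRingType.
Implicit Types c f g : series R.
Local Notation q := (qvar R).

Lemma sdil_qfac k c a b : (0 < k)%N -> (0 < a)%N -> (0 < b)%N ->
  sdil k (qfac c a b) = qfac (sdil k c) (k * a) (k * b).
Proof.
move=> k0 a0 b0; apply: slim_unique (slim_dil k (slim_qfac c a0 b0)) _.
apply: slim_ext (slim_qfac (sdil k c) _ _) => [m||]; try by rewrite muln_gt0 k0.
rewrite rmorph_prod; apply: eq_bigr => i _; rewrite /qterm rmorphD rmorph1 rmorphM.
by rewrite rmorphXn /= sdil_qvar // -exprM; congr (1 + _ * _ ^+ _); lia.
Qed.

Lemma sneg_qfac c a b : (0 < a)%N -> ~~ odd a -> (0 < b)%N ->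
  sneg (qfac c a b) = qfac ((-1) ^+ b * sneg c) a b.
Proof.
move=> a0 ea b0; apply: slim_unique (slim_neg (slim_qfac c a0 b0)) _.
apply: slim_ext (slim_qfac _ a0 b0) => m.
rewrite rmorph_prod; apply: eq_bigr => i _; rewrite /qterm rmorphD rmorph1 rmorphM.
rewrite rmorphXn /= sneg_qvar [in RHS]exprNn.
have -> : (-1) ^+ (a * i + b) = (-1) ^+ b :> series R.
  by rewrite exprD exprM -[(-1) ^+ a]signr_odd (negbTE ea) expr1n mul1r.
by rewrite mulrA [sneg c * _]mulrC.
Qed.

Lemma qfacN c a b : (0 < a)%N -> (0 < b)%N ->
  qfac c a b * qfac (- c) a b = qfac (- (c * c)) (2 * a) (2 * b).
Proof.
move=> a0 b0.
apply: slim_unique (slimM (slim_qfac c a0 b0) (slim_qfac (- c) a0 b0)) _.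
apply: slim_ext (slim_qfac _ _ _) => [m||]; try by rewrite muln_gt0.
rewrite -big_split /=; apply: eq_bigr => i _; rewrite /qterm.
rewrite (_ : 2 * a * i + 2 * b = (a * i + b) + (a * i + b))%N; last by lia.
by rewrite exprD; ring.
Qed.

Definition euler k : series R := qfac (-1) k k.

Lemma euler0 k : (0 < k)%N -> euler k 0%N = 1.
Proof. by move=> k0; apply: qfac0. Qed.

Lemma sdil_euler k l : (0 < k)%N -> (0 < l)%N -> sdil k (euler l) = euler (k * l).
Proof. by move=> k0 l0; rewrite sdil_qfac // rmorphN1. Qed.

Let odd_part := qfac (-1 : series R) 2 1.
Definition oddfac : series R := qfac 1 2 1.

Let euler1_split : euler 1 = odd_part * euler 2.
Proof. by rewrite /euler (@qfac_split _ 2) // !big_ord_recl big_ord0 mulr1. Qed.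

Let oddfacN : oddfac * odd_part = sdil 2 odd_part.
Proof. by rewrite qfacN // mulr1 sdil_qfac // rmorphN1. Qed.

(** [oddfac] is the generating function of partitions into distinct odd parts. *)
Lemma psi_oddfac : psi R = oddfac * euler 4.
Proof.
rewrite psi_prod; congr (_ * _).
by rewrite /oddfac [in RHS](@qfac_split _ 2) // !big_ord_recl big_ord0 mulr1.
Qed.

(** (-q; q^2)(q; q^2) is (q; q^2) at q^2, and f_1 = (q; q^2) f_2. *)
Lemma psi_euler : psi R * euler 1 = euler 2 ^+ 2.
Proof.
rewrite psi_oddfac euler1_split expr2 mulrACA oddfacN.
have -> : euler 4 = sdil 2 (euler 2) by rewrite sdil_euler.
have -> : sdil 2 odd_part * (sdil 2 (euler 2) * euler 2) =
  sdil 2 odd_part * sdil 2 (euler 2) * euler 2 by ring.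
by rewrite -rmorphM -euler1_split /= sdil_euler.
Qed.

Lemma sneg_psi_euler : sneg (psi R) * euler 2 = euler 1 * euler 4.
Proof.
rewrite psi_oddfac rmorphM /= !sneg_qfac // rmorph1 rmorphN1 expr1 mulr1.
have -> : (-1) ^+ 4 * -1 = -1 :> series R by ring.
rewrite euler1_split.
by rewrite -/odd_part -/(euler 4); ring.
Qed.

(** Sorting the factors of (-q; q) modulo 3 gives (-q; q) = h (-q^3; q^3), where
    A = h f_3, while (-q; q) f_1 = f_2. *)
Lemma pent_euler : pent R * euler 1 * euler 6 = euler 2 * euler 3 ^+ 2.
Proof.
rewrite pent_prod; set h := qfac 1 3 1 * qfac 1 3 2.
have hg : qfac 1 1 1 = h * sdil 3 (qfac 1 1 1) :> series R.
  rewrite sdil_qfac // rmorph1 {1}(@qfac_split _ 3) // !big_ord_recl big_ord0.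
  by rewrite mulr1 /h -!mulrA.
have ge : qfac 1 1 1 * euler 1 = euler 2 by rewrite qfacN // mulr1.
have ge3 : sdil 3 (qfac 1 1 1) * euler 3 = euler 6.
  have -> : euler 6 = sdil 3 (euler 2) by rewrite sdil_euler.
  by rewrite -ge rmorphM /= sdil_euler.
rewrite -ge3 -ge {2}hg -/(euler 3); ring.
Qed.

(** The exponents are 6k(3k + 1), and the sign of the term is that of (-1)^k. *)
Lemma pentagonal12 :
  slim (fun m => \sum_(j < (2 * m).+1)
     theta_term (-1 * q ^+ 24) (-1 * q ^+ 12) (j%:Z - m%:Z)) (euler 12).
Proof.
have -> : euler 12 = qfac (-1) (24 + 12) 24 * qfac (-1) (24 + 12) 12 *
    qfac (-1) (24 + 12) (24 + 12).
  rewrite /euler (@qfac_split _ 3) // !big_ord_recl big_ord0 mulr1.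
  by rewrite mulrCA mulrA.
by apply: jtp => //; ring.
Qed.

Definition sumdiv n := (\sum_(1 <= d < n.+1 | d %| n) d)%N.
Definition Sumdiv : series R := Series (fun n => (sumdiv n)%:R).

Lemma sumdiv0 : sumdiv 0 = 0%N. Proof. by rewrite /sumdiv big_geq. Qed.

Lemma perm_divisors n m : (0 < n)%N -> (n <= m)%N ->
  perm_eq [seq d <- index_iota 1 m.+1 | (d %| n)%N] (divisors n).
Proof.
move=> n0 nm; apply: uniq_perm; rewrite ?divisors_uniq ?filter_uniq ?iota_uniq //.
move=> d; rewrite mem_filter -dvdn_divisors //; case: (boolP (d %| n)%N) => //= dn.
have d0 := dvdn_gt0 n0 dn; have dle := dvdn_leq n0 dn.
by rewrite mem_index_iota; lia.
Qed.

Lemma sumdivE n : (0 < n)%N -> sumdiv n = (\sum_(d <- divisors n) d)%N.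
Proof.
by move=> n0; rewrite /sumdiv -big_filter; apply/perm_big/perm_divisors.
Qed.

Lemma sumdiv_quot n : (0 < n)%N -> (\sum_(d <- divisors n) n %/ d)%N = sumdiv n.
Proof.
move=> n0; rewrite sumdivE // -(big_map (fun d => n %/ d)%N xpredT id).
apply: perm_big; apply: uniq_perm; rewrite ?divisors_uniq //.
  rewrite map_inj_in_uniq ?divisors_uniq // => d e.
  rewrite -!dvdn_divisors // => /dvdnP[a ea] /dvdnP[b eb].
  by have [d0 e0] : (0 < d /\ 0 < e)%N; [lia|rewrite {1}ea eb !mulnK //; nia].
move=> d; rewrite -dvdn_divisors //; apply/mapP/idP => [[e]|dn].
  by rewrite -dvdn_divisors // => en ->; apply/dvdnP; exists e; rewrite mulnC divnK.
move: dn n0 => /dvdnP[e ->]; rewrite muln_gt0 => /andP[e0 d0].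
exists e; last by rewrite mulKn.
by rewrite -dvdn_divisors ?muln_gt0 ?e0 ?dvdn_mulr.
Qed.

Lemma big_divisors (n m : nat) (F : nat -> R) : (0 < n)%N -> (n <= m)%N ->
  \sum_(i < m | (i.+1 %| n)%N) F i.+1 = \sum_(d <- divisors n) F d.
Proof.
move=> n0 nm; rewrite -(perm_big _ (perm_divisors n0 nm)) /= big_filter.
by rewrite big_add1 big_mkord.
Qed.

(* q/(1 - q) and q/(1 - q)^2 *)
Let geo : series R := Series (fun j => (0 < j)%N%:R).
Let geo2 : series R := Series (fun j => j%:R).

Let geoE : (1 - q) * geo = q.
Proof.
apply: seriesP => -[|n]; rewrite mulrBl mul1r scoefB scoef_qvarM /= ?subr0 //.
by case: n => [|n] /=; rewrite ?subr0 ?subrr.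
Qed.

Let geo2E : (1 - q) ^+ 2 * geo2 = q.
Proof.
rewrite expr2 -mulrA (_ : (1 - q) * geo2 = geo) ?geoE //.
apply: seriesP => -[|n]; rewrite mulrBl mul1r scoefB scoef_qvarM /= ?subr0 //.
by rewrite -natrB // subSnn.
Qed.

(* The two Lambert expansions of S: each divisor d of n is reached once as the
   index, and once as the cofactor n / d. *)
Let slim_Sumdiv1 : slim (fun m => \sum_(i < m) i.+1%:R * sdil i.+1 geo) Sumdiv.
Proof.
move=> n; exists n => m nm [|i] lin; rewrite scoef_sum.
  have -> : Sumdiv 0%N = 0 by rewrite /= sumdiv0.
  by rewrite big1 // => j _; rewrite scoefMnat scoef_dil0 mulr0.
have -> : Sumdiv i.+1 = (sumdiv i.+1)%:R by [].
rewrite sumdivE // natr_sum -(@big_divisors _ m) //; last by lia.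
rewrite [RHS]big_mkcond; apply: eq_bigr => j _; rewrite scoefMnat /=.
case: ifP => [d|_]; last by rewrite mulr0.
have -> : (0 < i.+1 %/ j.+1)%N by rewrite divn_gt0 // dvdn_leq.
by rewrite mulr1.
Qed.

Let slim_Sumdiv2 : slim (fun m => \sum_(i < m) sdil i.+1 geo2) Sumdiv.
Proof.
move=> n; exists n => m nm [|i] lin; rewrite scoef_sum.
  by rewrite /= sumdiv0 big1 // => j _; rewrite dvdn0 div0n.
rewrite /= -sumdiv_quot // natr_sum -(@big_divisors _ m) //; last by lia.
by rewrite [RHS]big_mkcond; apply: eq_bigr.
Qed.

(** The logarithmic derivative of 1 - q^n is -n q^n / (1 - q^n); the sum over n is
    a Lambert series of S. *)
Lemma sder_euler1 : sder (euler 1) = - (euler 1 * Sumdiv).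
Proof.
have le := slim_qfac (-1 : series R) (isT : 0 < 1)%N (isT : 0 < 1)%N.
apply: slim_unique (slim_der le) _.
rewrite -[- (_ * Sumdiv)]mulN1r.
apply: slim_ext (slimM (slim_cst (-1)) (slimM le slim_Sumdiv1)) => m.
elim: m => [|m IH]; first by rewrite !big_ord0 sder1; ring.
rewrite !big_ord_recr /= sderM -IH.
set P := \prod_(i < m) _; set T := \sum_(i < m) _.
have -> : sder (qterm (-1) 1 1 m) =
    - (qterm (-1) 1 1 m * (m.+1%:R * sdil m.+1 geo)) :> series R.
  rewrite /qterm mul1n addn1 mulN1r sderD sderN sder1 sderX sder_qvar /=.
  have := congr1 (sdil m.+1) geoE; rewrite rmorphM rmorphB rmorph1 /= sdil_qvar //.
  move=> e; rewrite mulrCA e exprSr; ring.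
ring.
Qed.

(** (1 - x^3) / (1 - x)^3 = 1 + 3x / (1 - x)^2, and a product of factors 1 + 3s is
    1 plus 3 times the sum of the s modulo 9; the sum over x = q^n of
    x / (1 - x)^2 is the other Lambert series of S. *)
Lemma euler3_mod9 : 9%:R = 0 :> R ->
  euler 3 = euler 1 ^+ 3 * (1 + 3%:R * Sumdiv).
Proof.
move=> h9; have h9' : 9%:R = 0 :> series R.
  by apply: seriesP => n; rewrite scoef_nat natrM h9 mul0r.
have l1 := slim_qfac (-1 : series R) (isT : 0 < 1)%N (isT : 0 < 1)%N.
have l3 := slim_qfac (-1 : series R) (isT : 0 < 3)%N (isT : 0 < 3)%N.
apply: slim_unique l3 _.
have -> : euler 1 ^+ 3 = euler 1 * (euler 1 * euler 1) by ring.
apply: slim_ext (slimM (slimM l1 (slimM l1 l1))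
  (slimD (slim_cst 1) (slimM (slim_cst 3%:R) slim_Sumdiv2))) => m.
elim: m => [|m IH]; first by rewrite !big_ord0; ring.
rewrite !big_ord_recr /= -IH.
set P := \prod_(i < m) _; set T := \sum_(i < m) _; set s := sdil _ _.
have := congr1 (sdil m.+1) geo2E.
rewrite rmorphM rmorphXn rmorphB rmorph1 /= sdil_qvar // -/s => eX.
have -> : qterm (-1) 3 3 m =
    (1 - q ^+ m.+1) ^+ 3 * (1 + 3%:R * s) :> series R.
  rewrite /qterm (_ : 3 * m + 3 = m.+1 * 3)%N ?exprM; last by lia.
  rewrite [RHS](_ : _ = (1 - q ^+ m.+1) * ((1 - q ^+ m.+1) ^+ 2 +
    3%:R * ((1 - q ^+ m.+1) ^+ 2 * s))); first by rewrite eX; ring.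
  ring.
have -> : qterm (-1) 1 1 m = 1 - q ^+ m.+1 :> series R.
  by rewrite /qterm mul1n addn1 mulN1r.
set w := 1 - _.
transitivity (P * (P * P) * (1 + 3%:R * T) * (w ^+ 3 * (1 + 3%:R * s)) -
  9%:R * (P * (P * P) * T * w ^+ 3 * s)); first by ring.
by rewrite h9' mul0r subr0.
Qed.

(** The divisors of n and of p n that are prime to p are the same, and the other
    divisors of p n are the p d with d dividing n. *)
Lemma sumdiv_hecke p n : prime p -> (0 < n)%N ->
  (sumdiv (p * n) + p * (if p %| n then sumdiv (n %/ p) else 0) =
   p.+1 * sumdiv n)%N.
Proof.
move=> pp n0; have p0 := prime_gt0 pp.
have mult k : (0 < k)%N ->
    (\sum_(d <- divisors (p * k) | p %| d) d = p * sumdiv k)%N.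
  move=> k0; rewrite sumdivE // big_distrr /= -big_filter.
  rewrite -(big_map (fun d => p * d)%N xpredT id).
  apply: perm_big; apply: uniq_perm.
  - by rewrite filter_uniq ?divisors_uniq.
  - rewrite map_inj_uniq ?divisors_uniq // => i j /eqP.
    by rewrite eqn_pmul2l // => /eqP.
  move=> d; rewrite mem_filter -dvdn_divisors ?muln_gt0 ?p0 //.
  apply/andP/mapP => [[/dvdnP[e ->]]|[e]].
    rewrite mulnC dvdn_pmul2l // => ek.
    by exists e => //; rewrite -dvdn_divisors.
  by rewrite -dvdn_divisors // => ek ->; rewrite dvdn_pmul2l // dvdn_mulr.
have prim : (\sum_(d <- divisors (p * n) | ~~ (p %| d)) d =
             \sum_(d <- divisors n | ~~ (p %| d)) d)%N.
  rewrite -big_filter -[in RHS]big_filter.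
  apply: perm_big; apply: uniq_perm; rewrite ?filter_uniq ?divisors_uniq //.
  move=> d; rewrite !mem_filter -!dvdn_divisors ?muln_gt0 ?p0 //.
  case: (boolP (p %| d)%N) => //= pd; rewrite Gauss_dvdr //.
  by rewrite coprime_sym prime_coprime.
have split k : (0 < k)%N -> sumdiv k = (\sum_(d <- divisors k | p %| d) d +
    \sum_(d <- divisors k | ~~ (p %| d)) d)%N.
  by move=> k0; rewrite sumdivE // (bigID (fun d => p %| d)%N).
rewrite (split (p * n)%N) ?muln_gt0 ?p0 // mult // prim.
rewrite mulSn {2}(split n) // -addnA addnC; congr addn.
rewrite addnC; congr addn; case: ifP => [/dvdnP[k nk]|pn].
  have k0 : (0 < k)%N by move: n0; rewrite nk muln_gt0 => /andP[].
  by rewrite mulnC in nk; rewrite nk mulKn // mult.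
rewrite muln0 big_seq_cond big1 // => d; rewrite -dvdn_divisors //.
by case/andP=> dn pd; rewrite (dvdn_trans pd dn) in pn.
Qed.

(** If d e = 2 mod 3, then {d, e} = {1, 2} mod 3 and d + e = 0 mod 3: the divisors
    of 3n + 2 cancel in pairs. *)
Lemma dvd3_sumdiv n : (3 %| sumdiv (3 * n + 2))%N.
Proof.
set N := (3 * n + 2)%N; have N0 : (0 < N)%N by rewrite /N; lia.
have : (3 %| 2 * sumdiv N)%N.
  rewrite mul2n -addnn {2}(sumdivE N0) -(sumdiv_quot N0) -big_split /=.
  rewrite big_seq; apply: dvdn_sum => d; rewrite -dvdn_divisors // => /dvdnP[e eN].
  have d0 : (0 < d)%N by nia.
  rewrite eN mulnK //; have := divn_eq d 3; have := divn_eq e 3.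
  have : (d %% 3 < 3)%N by rewrite ltn_mod.
  have : (e %% 3 < 3)%N by rewrite ltn_mod.
  move: (d %% 3)%N (d %/ 3)%N (e %% 3)%N (e %/ 3)%N => r a s b s3 r3 ee de.
  suff [t ->] : exists t : nat, (e + d = 3 * t)%N by rewrite dvdn_mulr.
  have : (e * d = 9 * (a * b) + 3 * (b * r) + 3 * (a * s) + r * s)%N.
    by rewrite ee de; ring.
  rewrite -eN /N; move: (a * b)%N => ab; clear -r3 s3 ee de.
  have : (r = 0 \/ r = 1 \/ r = 2)%N by lia.
  have : (s = 0 \/ s = 1 \/ s = 2)%N by lia.
  by move=> [|[|]] ss [|[|]] rr eq; subst r s;
    [exfalso|exfalso|exfalso|exfalso|exfalso|exists (a + b + 1)%N|
     exfalso|exists (a + b + 1)%N|exfalso]; lia.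
by rewrite Gauss_dvdr.
Qed.
End Eta.

(** * Splitting exponents modulo 3 *)

Section Trisection.
Variable R : comNzRingType.
Local Notation q := (qvar R).
Implicit Types a b : series R.

Definition trisect a0 a1 a2 : series R :=
  sdil 3 a0 + q * sdil 3 a1 + q ^+ 2 * sdil 3 a2.

Lemma trisect_coef a0 a1 a2 n :
  [/\ trisect a0 a1 a2 (3 * n)%N = a0 n, trisect a0 a1 a2 (3 * n + 1)%N = a1 n &
      trisect a0 a1 a2 (3 * n + 2)%N = a2 n].
Proof.
have E a m : sdil 3 a m = if (3 %| m)%N then a (m %/ 3)%N else 0 by [].
rewrite /trisect -[q in q * _]expr1; split; rewrite !scoefD !scoef_qvarXM !E.
- case: n => [|n]; first by rewrite muln0 dvdn0 !addr0.
  rewrite dvdn_mulr // mulKn //.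
  rewrite (_ : (3 %| 3 * n.+1 - 1)%N = false); last by lia.
  rewrite (_ : (3 %| 3 * n.+1 - 2)%N = false); last by lia.
  by rewrite !if_same !addr0.
- rewrite (_ : (3 %| 3 * n + 1)%N = false); last by lia.
  rewrite addnK dvdn_mulr // mulKn // leq_addl add0r.
  case: n => [|n]; first by rewrite addr0.
  rewrite (_ : (3 %| 3 * n.+1 + 1 - 2)%N = false); last by lia.
  by rewrite if_same addr0.
rewrite (_ : (3 %| 3 * n + 2)%N = false); last by lia.
rewrite (_ : (3 %| 3 * n + 2 - 1)%N = false); last by lia.
by rewrite addnK dvdn_mulr // mulKn // if_same !add0r leq_addl.
Qed.

Lemma trisect_inj a0 a1 a2 b0 b1 b2 : trisect a0 a1 a2 = trisect b0 b1 b2 ->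
  [/\ a0 = b0, a1 = b1 & a2 = b2].
Proof.
move=> e; split; apply: seriesP => n;
  have [x0 x1 x2] := trisect_coef a0 a1 a2 n;
  have [y0 y1 y2] := trisect_coef b0 b1 b2 n.
- by rewrite -x0 -y0 e.
- by rewrite -x1 -y1 e.
- by rewrite -x2 -y2 e.
Qed.

(** 8(3n) + 1 = 24n + 1; 8(3n + 1) + 1 = 9 (8n/3 + 1) is a square iff n = 3k with
    8k + 1 a square; 8(3n + 2) + 1 is 2 mod 3, hence not a square. *)
Lemma psi_trisection : psi R = sdil 3 (pent R) + q * sdil 9 (psi R).
Proof.
rewrite (_ : sdil 9 _ = sdil 3 (sdil 3 (psi R))); last by rewrite sdil_comp.
have -> : sdil 3 (pent R) + q * sdil 3 (sdil 3 (psi R)) =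
  trisect (pent R) (sdil 3 (psi R)) 0 by rewrite /trisect rmorph0 mulr0 addr0.
apply: seriesP => N; have -> : N = (3 * (N %/ 3) + N %% 3)%N by lia.
have : (N %% 3 < 3)%N by rewrite ltn_mod.
move: (N %/ 3)%N (N %% 3)%N => n r r3.
have [e0 e1 e2] := trisect_coef (pent R) (sdil 3 (psi R)) 0 n.
have [->|[->|->]] : (r = 0 \/ r = 1 \/ r = 2)%N by lia.
- by rewrite addn0 e0 /= mulnA.
- rewrite e1 /=; have [/dvdnP[k ->]|n3] := ifPn.
    rewrite mulnK //; congr (nat_of_bool _)%:R; apply/is_squareP/is_squareP.
      move=> [i ii]; have := divn_eq i 3; have : (i %% 3 < 3)%N by rewrite ltn_mod.
      move: (i %% 3)%N (i %/ 3)%N => r' d r'3 di.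
      have rr : r' = 0%N by nia.
      by exists d; rewrite rr addn0 in di; nia.
    by move=> [i ii]; exists (3 * i)%N; nia.
  rewrite (_ : is_square _ = false) //; apply/negbTE/is_squareP => -[i ii].
  have := divn_eq i 3; have : (i %% 3 < 3)%N by rewrite ltn_mod.
  move: (i %% 3)%N (i %/ 3)%N => r' d r'3 di.
  have rr : r' = 0%N by nia.
  case/negP: n3; apply/dvdnP; rewrite rr addn0 in di.
  have e : (8 * n + 3 = 3 * (d * d))%N by nia.
  have : (3 %| 8 * n)%N by rewrite -(dvdn_addl _ (dvdnn 3)) e dvdn_mulr.
  by rewrite Gauss_dvdr // => /dvdnP.
rewrite e2 /= (_ : is_square _ = false) //; apply/negbTE/is_squareP => -[i ii].
have := divn_eq i 3; have : (i %% 3 < 3)%N by rewrite ltn_mod.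
move: (i %% 3)%N (i %/ 3)%N => r' d r'3 di.
have : (r' = 0 \/ r' = 1 \/ r' = 2)%N by lia.
by move=> [|[|]] rr; subst r'; nia.
Qed.

End Trisection.

(** * Characteristic 3 *)

Section Char3.
Variable R : comNzRingType.
Hypothesis h3 : 3%:R = 0 :> R.
Local Notation q := (qvar R).
Local Notation f := (euler R).
Local Notation psi := (psi R).
Local Notation A := (pent R).
Local Notation S := (Sumdiv R).

Let h3s : 3%:R = 0 :> series R.
Proof. by apply: seriesP => n; rewrite scoef_nat natrM h3 mul0r. Qed.

(* [ring] proves an identity in characteristic 3 once the multiple of 3 is
   given. *)
Let eq_char3 (T : comNzRingType) (x y w : T) :
  3%:R = 0 :> T -> x = y + 3%:R * w -> x = y.
Proof. by move=> e ->; rewrite e mul0r addr0. Qed.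

Let c0X k n : (0 < k)%N -> (f k ^+ n) 0%N = 1.
Proof.
move=> k0; elim: n => // n IH; rewrite exprS scoefM0 IH euler0 ?mulr1 //.
Qed.

Lemma euler3_char3 : f 3 = f 1 ^+ 3.
Proof.
have l1 := slim_qfac (-1 : series R) (isT : 0 < 1)%N (isT : 0 < 1)%N.
have l3 := slim_qfac (-1 : series R) (isT : 0 < 3)%N (isT : 0 < 3)%N.
apply: slim_unique l3 _.
have -> : f 1 ^+ 3 = f 1 * (f 1 * f 1) by ring.
apply: slim_ext (slimM l1 (slimM l1 l1)) => m.
rewrite -!big_split /=; apply: eq_bigr => i _; rewrite /qterm.
rewrite (_ : 3 * i + 3 = (1 * i + 1) * 3)%N ?exprM; last by lia.
set X := q ^+ _; apply: (@eq_char3 _ _ _ (X ^+ 2 - X)) => //; ring.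
Qed.

Let f6 : f 6 = f 2 ^+ 3.
Proof.
have -> : f 6 = sdil 2 (f 3) by rewrite sdil_euler.
by rewrite euler3_char3 rmorphXn /= sdil_euler.
Qed.

Let psiE : psi * f 1 = f 2 ^+ 2 := psi_euler R.

Let pentE : A * f 2 ^+ 2 = f 1 ^+ 5.
Proof.
apply: (@smulI _ (f 1 * f 2)); first by rewrite scoefM0 !euler0 ?mulr1.
have := pent_euler R; rewrite f6 euler3_char3 => e.
transitivity (A * f 1 * f 2 ^+ 3); first by ring.
by rewrite e; ring.
Qed.

Let pent3 : sdil 3 A = A ^+ 3.
Proof.
apply: (@smulI _ (f 2 ^+ 6)); first exact: c0X.
have := congr1 (sdil 3) pentE.
rewrite rmorphM !rmorphXn /= !sdil_euler // f6 euler3_char3 => e.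
transitivity (sdil 3 A * (f 2 ^+ 3) ^+ 2); first by ring.
rewrite e; transitivity ((A * f 2 ^+ 2) ^+ 3); last by ring.
by rewrite pentE; ring.
Qed.

Let psi3 : sdil 3 psi = psi ^+ 3.
Proof.
apply: (@smulI _ (f 1 ^+ 3)); first exact: c0X.
have := congr1 (sdil 3) psiE.
rewrite rmorphM !rmorphXn /= !sdil_euler // f6 euler3_char3 => e.
rewrite mulrC e; transitivity ((psi * f 1) ^+ 3); last by ring.
by rewrite psiE; ring.
Qed.

Let psi_split : psi = A ^+ 3 + q * psi ^+ 9.
Proof.
rewrite {1}psi_trisection pent3.
rewrite (_ : sdil 9 _ = sdil 3 (sdil 3 psi)); last by rewrite sdil_comp.
rewrite psi3 rmorphXn /= psi3; ring.
Qed.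

(** D kills the cube A^3, and 3 = 0 kills the derivative of psi^9. *)
Lemma sder_psi : sder psi = q * psi ^+ 9.
Proof.
rewrite {1}psi_split sderD sderM !sderX sder_qvar h3s !mul0r add0r.
by apply: (@eq_char3 _ _ _ (q * (3%:R * psi ^+ 8 * sder psi))) => //; ring.
Qed.

Let psi0 : psi 0%N = 1.
Proof.
have : (psi * f 1) 0%N = (f 2 ^+ 2) 0%N by rewrite psiE.
by rewrite c0X // scoefM0 euler0 // mulr1.
Qed.

Let euler2_der : sder (f 2) = - (2%:R * f 2 * sdil 2 S).
Proof.
have -> : f 2 = sdil 2 (f 1) by rewrite sdil_euler.
by rewrite sder_dil sder_euler1 rmorphN rmorphM /= mulrN mulrA.
Qed.

(** The logarithmic derivative of psi f_1 = f_2^2, where D psi / psi = q psi^8. *)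
Lemma Sumdiv_psi : S - sdil 2 S = q * psi ^+ 8.
Proof.
apply: (@smulI _ (psi * f 1)); first by rewrite scoefM0 psi0 euler0 ?mulr1.
have := congr1 (@sder R) psiE.
rewrite sderM sder_psi sder_euler1 sderX euler2_der /= expr1 => e.
have e' : q * psi ^+ 9 * f 1 = psi * f 1 * S - 4%:R * f 2 ^+ 2 * sdil 2 S.
  by rewrite -[LHS](addrK (psi * - (f 1 * S))) e; ring.
rewrite -psiE in e'.
transitivity (q * psi ^+ 9 * f 1); last by ring.
by rewrite e'; apply: (@eq_char3 _ _ _ (psi * f 1 * sdil 2 S)) => //; ring.
Qed.

Definition Sumdiv31 : series R := Series (fun n => (sumdiv (3 * n + 1))%:R).

Let natr3 (n : nat) : (3 %| n)%N -> n%:R = 0 :> R.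
Proof. by move=> /dvdnP[k ->]; rewrite natrM h3 mulr0. Qed.

Let Sumdiv_split : S = sdil 3 S + q * sdil 3 Sumdiv31.
Proof.
have -> : sdil 3 S + q * sdil 3 Sumdiv31 = trisect S Sumdiv31 0.
  by rewrite /trisect rmorph0 mulr0 addr0.
apply: seriesP => N; have -> : N = (3 * (N %/ 3) + N %% 3)%N by lia.
have : (N %% 3 < 3)%N by rewrite ltn_mod.
move: (N %/ 3)%N (N %% 3)%N => n r r3.
have [e0 e1 e2] := trisect_coef S Sumdiv31 0 n.
have [->|[->|->]] : (r = 0 \/ r = 1 \/ r = 2)%N by lia.
- rewrite addn0 e0 /=; have [->|n0] := posnP n; first by rewrite muln0.
  have := congr1 (fun k => k%:R : R) (@sumdiv_hecke 3 n isT n0).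
  by rewrite natrD !natrM h3 mul0r addr0 -natr1 h3 add0r mul1r.
- by rewrite e1.
by rewrite e2 /= natr3 // dvd3_sumdiv.
Qed.

(** With X = S - S(q^2), the identity psi X = q psi(q^3)^3 splits into three
    equations according to the exponent modulo 3:
    A X = q psi^3 W(q^2), A W + psi^3 X = psi^3 and psi^3 W = A W(q^2).  Eliminating
    X and W(q^2) leaves (A^3 + q psi^9) W = A^2 psi^3, whose left-hand side is
    psi W. *)
Lemma Sumdiv31_theta : Sumdiv31 = A ^+ 2 * psi ^+ 2.
Proof.
set X := S - sdil 2 S.
have XE : X = trisect X Sumdiv31 (- sdil 2 Sumdiv31).
  rewrite {1}/X {1 2}Sumdiv_split /trisect /X !rmorphB rmorphN rmorphD rmorphM /=.
  rewrite sdil_qvar // !sdil_comp //=; ring.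
have e : psi * X = q * sdil 3 (psi ^+ 3).
  by rewrite /X Sumdiv_psi rmorphXn /= psi3; ring.
clearbody X; have := e; rewrite {1}XE {1}psi_trisection.
rewrite (_ : sdil 9 _ = sdil 3 (sdil 3 psi)); last by rewrite sdil_comp.
rewrite psi3 => e1.
have : trisect (A * X - q * psi ^+ 3 * sdil 2 Sumdiv31) (A * Sumdiv31 + psi ^+ 3 * X)
   (psi ^+ 3 * Sumdiv31 - A * sdil 2 Sumdiv31) = trisect 0 (psi ^+ 3) 0.
  rewrite [RHS]/trisect !rmorph0 mulr0 addr0 add0r -e1 /trisect.
  rewrite !rmorphB !rmorphD !rmorphM rmorphN /= sdil_qvar //; ring.
move/trisect_inj => [/subr0_eq g0 g1 /subr0_eq g2].
apply: (@smulI _ psi) => //.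
transitivity (A ^+ 2 * psi ^+ 3); last by ring.
rewrite -g1 {1}psi_split.
transitivity (A ^+ 3 * Sumdiv31 + q * psi ^+ 6 * (psi ^+ 3 * Sumdiv31)); first by ring.
rewrite g2; transitivity (A ^+ 3 * Sumdiv31 + A * psi ^+ 3 * (q * psi ^+ 3 * sdil 2 Sumdiv31)).
  by ring.
by rewrite -g0; ring.
Qed.

Let Sumdiv31_euler : Sumdiv31 = f 1 ^+ 8.
Proof.
apply: (@smulI _ (f 2 ^+ 4 * f 1 ^+ 2)); first by rewrite scoefM0 !c0X ?mulr1.
rewrite Sumdiv31_theta.
transitivity ((A * f 2 ^+ 2) ^+ 2 * (psi * f 1) ^+ 2); first by ring.
by rewrite pentE psiE; ring.
Qed.

(** Both sides equal minus the value at -q of S(q) - S(q^2).  For even exponents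
    this uses sigma(2m) = sigma(m/2) mod 3, which is Hecke's relation at 2. *)
Lemma Sumdiv_sneg : S + sdil 2 S + sdil 4 S = q * sneg psi ^+ 8.
Proof.
have -> : q * sneg psi ^+ 8 = - sneg (S - sdil 2 S).
  by rewrite Sumdiv_psi rmorphM rmorphXn /= sneg_qvar; ring.
rewrite -[4%N]/(2 * 2)%N -sdil_comp //.
apply: seriesP => n; rewrite !scoefD scoefN.
have -> : sneg (S - sdil 2 S) n = (-1) ^+ n * (S n - sdil 2 S n) by [].
rewrite -signr_odd.
have E a m : sdil 2 a m = if (2 %| m)%N then a (m %/ 2)%N else 0 by [].
rewrite !E !dvdn2; case: (boolP (odd n)) => /= on.
  by rewrite expr1 !addr0 subr0 mulN1r opprK.
rewrite expr0 mul1r [(n %/ 2)%N]divn2; set m := n./2.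
have nm : n = (2 * m)%N by rewrite mul2n; move: on; rewrite /m; lia.
suff -> : (if ~~ odd m then (sumdiv (m %/ 2))%:R else 0) = (sumdiv n)%:R :> R.
  by apply: (@eq_char3 _ _ _ (sumdiv n)%:R) => //; ring.
have [m0|m0] := posnP m; first by rewrite nm m0.
have := congr1 (fun k => k%:R : R) (@sumdiv_hecke 2 m isT m0).
rewrite -nm dvdn2 natrD !natrM h3 mul0r.
case: ifP => _ /=; last by rewrite mulr0 addr0 => ->.
move=> e; apply: (@eq_char3 _ _ _ (sumdiv (m %/ 2))%:R) => //.
by rewrite -[LHS]addr0 -e; ring.
Qed.

(** The logarithmic derivative of A f_2^2 = f_1^5. *)
Lemma sder_pent : sder A = A * (S + sdil 2 S).
Proof.
apply: (@smulI _ (f 2 ^+ 2)); first exact: c0X.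
have := congr1 (@sder R) pentE.
rewrite sderM !sderX sder_euler1 euler2_der /= expr1 => e.
have e' : f 2 ^+ 2 * sder A =
   4%:R * (A * f 2 ^+ 2) * sdil 2 S - 5%:R * f 1 ^+ 5 * S.
  rewrite [LHS]mulrC -[LHS](addrK (A * (2%:R * f 2 * - (2%:R * f 2 * sdil 2 S)))) e.
  by ring.
rewrite e' -pentE.
by apply: (@eq_char3 _ _ _ (A * f 2 ^+ 2 * (sdil 2 S - 2%:R * S))) => //; ring.
Qed.

Let pent_Sumdiv31 : A * sdil 4 Sumdiv31 = psi ^+ 3 * sneg psi ^+ 8.
Proof.
rewrite Sumdiv31_euler rmorphXn /= sdil_euler //.
apply: (@smulI _ (f 2 ^+ 8 * f 1 ^+ 3)); first by rewrite scoefM0 !c0X ?mulr1.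
transitivity ((A * f 2 ^+ 2) * f 2 ^+ 6 * f 4 ^+ 8 * f 1 ^+ 3); first by ring.
transitivity ((psi * f 1) ^+ 3 * (sneg psi * f 2) ^+ 8); last by ring.
by rewrite pentE psiE sneg_psi_euler; ring.
Qed.

Let psi_sq : psi ^+ 2 = trisect (A ^+ 2) (2%:R * (A * psi ^+ 3)) (psi ^+ 6).
Proof.
rewrite {1}psi_trisection.
rewrite (_ : sdil 9 _ = sdil 3 (sdil 3 psi)); last by rewrite sdil_comp.
rewrite psi3 /trisect; ring.
Qed.

(** The part of psi^2 S(q^4) with exponents 1 mod 3 is
    2 A psi^3 S(q^4) + q A^2 W(q^4).  Since 2 = -1 and
    A W(q^4) = psi^3 psi(-q)^8, the formula for S(q) + S(q^2) + S(q^4) makes it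
    A psi^3 (S(q) + S(q^2)) = D(A psi^3), and D multiplies the coefficient of q^M
    by M. *)
Lemma psi_sq_Sumdiv4 M :
  2%:R * (psi ^+ 2 * sdil 4 S) (3 * M + 1)%N = M%:R * (psi ^+ 2) (3 * M + 1)%N.
Proof.
have S4 : sdil 4 S = sdil 3 (sdil 4 S) + q ^+ 4 * sdil 3 (sdil 4 Sumdiv31).
  rewrite {1}Sumdiv_split rmorphD rmorphM /= sdil_qvar // !sdil_comp //.
set W4 := sdil 4 Sumdiv31 in S4.
set a0 := A ^+ 2 * sdil 4 S + q ^+ 2 * psi ^+ 6 * W4.
set a2 := psi ^+ 6 * sdil 4 S + 2%:R * q * (A * psi ^+ 3) * W4.
have prodE : psi ^+ 2 * sdil 4 S = trisect a0 (sder (A * psi ^+ 3)) a2.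
  have -> : sder (A * psi ^+ 3) =
      2%:R * (A * psi ^+ 3) * sdil 4 S + q * A ^+ 2 * W4.
    rewrite sderM sder_pent sderX h3s !mul0r mulr0 addr0.
    transitivity (2%:R * (A * psi ^+ 3) * sdil 4 S +
      A * psi ^+ 3 * (S + sdil 2 S + sdil 4 S)).
      apply: esym; apply: (@eq_char3 _ _ _ (A * psi ^+ 3 * sdil 4 S)) => //; ring.
    rewrite Sumdiv_sneg; congr (_ + _).
    transitivity (q * A * (A * W4)); last by ring.
    by rewrite /W4 pent_Sumdiv31; ring.
  rewrite psi_sq {1}S4 /trisect /a0 /a2.
  have q3 : sdil 3 q = q ^+ 3 by rewrite sdil_qvar.
  ring: q3.
have [_ e1 _] := trisect_coef a0 (sder (A * psi ^+ 3)) a2 M.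
have [_ e2 _] := trisect_coef (A ^+ 2) (2%:R * (A * psi ^+ 3)) (psi ^+ 6) M.
rewrite prodE e1 psi_sq e2 scoefMnat; set g := A * psi ^+ 3.
by rewrite (_ : sder g M = M%:R * g M) // mulrCA.
Qed.
End Char3.

(** * The generating function of B *)

Section Counting.
Variable R : comNzRingType.
Local Notation q := (qvar R).

(** g is the generating function of A for the weight w.  Listing the elements of
    each weight records finiteness and the cardinal at once. *)
Definition counted (T : eqType) (A : set T) (w : T -> nat) (g : series R) :=
  forall n, exists s : seq T,
    [/\ uniq s, forall x, x \in s <-> A x /\ w x = n & g n = (size s)%:R].

Lemma counted_eq (T : eqType) (A B : set T) w g h n :
    counted A w g -> counted B w h ->
  (forall x, w x = n -> A x <-> B x) -> g n = h n.
Proof.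
move=> /(_ n)[s [us sA ->]] /(_ n)[t [ut tB ->]] AB.
congr (_%:R); apply/perm_size/uniq_perm => // x.
apply/idP/idP => [/sA [Ax xn]|/tB [Bx xn]].
  by apply/tB; split=> //; apply/AB.
by apply/sA; split=> //; apply/AB.
Qed.

Lemma counted_unique (T : eqType) (A : set T) w g h :
  counted A w g -> counted A w h -> g = h.
Proof. by move=> cg ch; apply: seriesP => n; exact: (counted_eq cg ch). Qed.

Lemma counted_ext (T : eqType) (A B : set T) w g :
  (forall x, A x <-> B x) -> counted A w g -> counted B w g.
Proof.
move=> AB cg n; have [s [us sA gn]] := cg n; exists s; split=> // x.
by split=> [/sA[/AB]|[/AB Ax xn]] //; apply/sA.
Qed.

Lemma counted_union (T : eqType) (A B : set T) w g h :
    (forall x, A x -> ~ B x) -> counted A w g -> counted B w h ->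
  counted (A `|` B) w (g + h).
Proof.
move=> AB /[swap] ch cg n; have [s [us sA gn]] := cg n; have [t [ut tB hn]] := ch n.
exists (s ++ t); split; last by rewrite scoefD gn hn size_cat natrD.
  rewrite cat_uniq us ut andbT; apply/hasPn => x /tB[Bx _]; apply/negP => /sA[Ax _].
  exact: AB Bx.
move=> x; rewrite mem_cat; split=> [/orP[/sA[]|/tB[]]|[[Ax|Bx] xn]].
- by split=> //; left.
- by split=> //; right.
- by apply/orP; left; apply/sA.
- by apply/orP; right; apply/tB.
Qed.

Lemma counted_cons (A : set (seq nat)) k g : counted A sumn g ->
  counted [set k :: s | s in A] sumn (q ^+ k * g).
Proof.
move=> cg n; rewrite scoef_qvarXM; case: leqP => [kn|nk].
  have [s [us sA gn]] := cg (n - k)%N; exists [seq k :: t | t <- s].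
  split; rewrite ?size_map //; first by rewrite map_inj_uniq // => x y [].
  move=> x; split=> [/mapP[t /sA[At tn] ->]|[[t At <-] /= tn]].
    by split; [exists t|rewrite /= tn subnKC].
  by apply/mapP; exists t => //; apply/sA; split=> //; rewrite -tn addKn.
exists [::]; split=> // x; rewrite in_nil; split=> // -[[t _ <-] /= e].
by move: nk; rewrite -e; lia.
Qed.

Lemma counted_prod (T U : eqType) (A : set T) (B : set U) w v g h :
    counted A w g -> counted B v h ->
  counted (A `*` B) (fun x => w x.1 + v x.2)%N (g * h).
Proof.
move=> cg ch n.
have [s sP] := choice cg; have [t tP] := choice ch.
exists (flatten [seq [seq (x, y) | x <- s i, y <- t (n - i)%N] | i <- iota 0 n.+1]).
split.
- elim: (n.+1) (0%N) => //= m IH i; rewrite cat_uniq IH andbT.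
  have [us sA _] := sP i; have [ut tB _] := tP (n - i)%N.
  rewrite allpairs_uniq // => /=; last by move=> [? ?] [? ?] _ _ [-> ->].
  apply/hasPn => -[x y] /flatten_mapP[j]; rewrite mem_iota => /andP[ij _].
  move=> /allpairsP[[x' y'] /= [xs yt [-> ->]]].
  apply/negP => /allpairsP[[x2 y2] /= [xs2 yt2 [e1 e2]]].
  have [_ sAj _] := sP j; have [_ xj] := (sAj _).1 xs.
  have := (sA _).1 xs2; rewrite -e1 xj => -[_ e]; lia.
- move=> [x y]; split=> [/flatten_mapP[i]|[[Ax By] xyn]].
    rewrite mem_iota add0n => /andP[_ lin] /allpairsP[[x' y'] /= [xs yt [-> ->]]].
    have [_ sA _] := sP i; have [_ tB _] := tP (n - i)%N.
    have [? ->] := (sA _).1 xs; have [? ->] := (tB _).1 yt.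
    by split=> //; rewrite subnKC.
  rewrite /= in Ax By xyn.
  apply/flatten_mapP; exists (w x); first by rewrite mem_iota; lia.
  have [_ sA _] := sP (w x); have [_ tB _] := tP (n - w x)%N.
  apply/allpairsP; exists (x, y); split=> //=; first by apply/sA.
  by apply/tB; split=> //; rewrite -xyn addKn.
rewrite size_flatten /shape -map_comp sumnE big_map natr_sum scoefM.
rewrite -(big_mkord xpredT (fun i => g i * h (n - i)%N)).
apply: eq_bigr => i _ /=; rewrite size_allpairs natrM.
by have [_ _ ->] := sP i; have [_ _ ->] := tP (n - i)%N.
Qed.

Lemma card_fset_set (T : choiceType) (A : set T) (s : seq T) :
  uniq s -> (forall x, x \in s <-> A x) -> finite_set A ->
  #|` fset_set A| = size s.
Proof.
move=> us sA fA; apply/perm_size/uniq_perm => // x.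
by rewrite in_fset_set //; apply/idP/idP => [/set_mem/sA|/sA/mem_set].
Qed.

Lemma counted_partitions (A : set (seq nat)) :
  (forall s, A s -> is_partition s) -> exists g, counted A sumn g.
Proof.
move=> Ap; pose An n := A `&` [set s | sumn s = n].
have fA n : finite_set (An n).
  apply: sub_finite_set (finite_partitions_le n) => s [/Ap ps /= sn].
  by split=> //; rewrite sn.
exists (Series (fun n => #|` fset_set (An n)|%:R)) => n.
exists (fset_set (An n)); split; rewrite ?fset_uniq // => x.
by rewrite in_fset_set //; split=> [/set_mem|/mem_set].
Qed.

Lemma sorted_geq_cons x s : sorted geq (x :: s) = all (geq x) s && sorted geq s.
Proof. by rewrite /= path_sortedE // => a b c /= ba ac; exact: leq_trans ac ba. Qed.

Lemma is_partition_cons x s :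
  is_partition (x :: s) = [&& (0 < x)%N, all (geq x) s & is_partition s].
Proof.
rewrite /is_partition sorted_geq_cons in_cons negb_or [(0 == x)%N]eq_sym lt0n.
by case: (x == 0%N) => //=; rewrite ?andbF // andbA.
Qed.

Lemma leq_sumn (s : seq nat) x : x \in s -> (x <= sumn s)%N.
Proof.
elim: s => //= y s IH; rewrite in_cons => /predU1P[->|/IH h].
  exact: leq_addr.
exact: leq_trans h (leq_addl _ _).
Qed.

Lemma counted_nil : counted [set [::]] sumn 1.
Proof.
case=> [|n]; [exists [:: [::]]|exists [::]]; split=> // x.
  by rewrite inE; split=> [/eqP ->|[-> _]].
by rewrite in_nil; split=> // -[->].
Qed.

Definition odd_partitions : set (seq nat) :=
  [set s | is_partition s /\ distinct_odd_parts s].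

(** Raising the bound from 2m to 2m + 2 allows the part 2m + 1, which occurs at
    most once and comes first: a factor 1 + q^(2m+1). *)
Lemma counted_odd_bounded m :
  counted (odd_partitions `&` [set s | all (fun x => x < 2 * m)%N s]) sumn
    (\prod_(i < m) qterm 1 2 1 i).
Proof.
elim: m => [|m IH].
  rewrite big_ord0; apply: counted_ext counted_nil => s; split=> [->|[_]] //.
  by case: s.
rewrite big_ord_recr /= /qterm mulrDr mulr1 mul1r [X in _ + X]mulrC.
apply: counted_ext (counted_union _ IH (counted_cons _ IH)); last first.
  by move=> s [_ /= sm] [t _ ts]; move: sm; rewrite -ts /=; lia.
move=> s; split.
  move=> [[ps sm]|[t [[pt /andP[ut ot]] /= tm] <-]].
    by split=> //; apply: sub_all sm => x; lia.
  have tlt x : x \in t -> (x < 2 * m)%N by move=> xt; exact: (allP tm).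
  split; last by apply/andP; split; [lia|apply: sub_all tm => x; lia].
  split; last first.
    rewrite /distinct_odd_parts /= ut ot andbT /= oddD oddM /= andbT.
    by apply/negP => /tlt; lia.
  rewrite is_partition_cons pt andbT addn1 /=.
  by apply/allP => x /tlt /=; lia.
case: s => [|x s] [[ps /andP[us os]] sm]; first by left.
move: ps us os sm; rewrite is_partition_cons => /and3P[x0 xs ps].
rewrite /= => /andP[xns us] /andP[ox os] /andP[xm sm].
have [xe|xne] := eqVneq x (2 * m + 1)%N.
  right; exists s; last by rewrite xe.
  split; first by split=> //; apply/andP.
  apply/allP => y ys; have := allP xs _ ys; have := allP os _ ys => oy /= yx.
  have : y != x by apply: contraNneq xns => <-.
  by have := odd_double_half y; rewrite oy; lia.
have xlt : (x < 2 * m)%N by have := odd_double_half x; rewrite ox; lia.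
left; split; last by rewrite /= xlt; apply: sub_all xs => y /=; lia.
split; first by rewrite is_partition_cons x0 xs.
by rewrite /distinct_odd_parts /= xns us ox os.
Qed.

Lemma counted_odd : counted odd_partitions sumn (oddfac R).
Proof.
move=> n; have [s [us sA e]] := counted_odd_bounded n.+1 n; exists s; split=> // x.
split=> [/sA[[]]|[ox xn]] //; apply/sA; split=> //; split=> //.
by apply/allP => y /leq_sumn /=; rewrite xn; lia.
Qed.

Definition partitions4 : set (seq nat) :=
  [set s | is_partition s /\ parts_divisible_by 4 s].

(** Let h m count the partitions with parts at most 4m.  Such a partition for
    m + 1 has parts at most 4m or is 4(m + 1) followed by another one, so that
    h (m + 1) (1 - q^(4(m+1))) = h m. *)
Lemma counted_4 g : counted partitions4 sumn g -> g * euler R 4 = 1.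
Proof.
move=> cg; pose E m := partitions4 `&` [set s | all (fun x => x <= 4 * m)%N s].
have [h hE] : exists h, forall m, counted (E m) sumn (h m).
  have ex m : exists g, counted (E m) sumn g.
    by apply: counted_partitions => s [[]].
  by have [h hE] := choice ex; exists h.
have h0 : h 0%N = 1.
  apply: counted_unique (hE 0%N) (counted_ext _ counted_nil) => s.
  split=> [->//|[[ps _] sm]]; case: s ps sm => // x s.
  by rewrite is_partition_cons /= => /and3P[x0 _ _] /andP[]; lia.
have hS m : h m.+1 = h m + q ^+ (4 * m.+1) * h m.+1.
  apply: counted_unique (hE _) _.
  apply: counted_ext (counted_union _ (hE m) (counted_cons _ (hE m.+1))); last first.
    by move=> s [_ /= sm] [t _ ts]; move: sm; rewrite -ts /=; lia.
  move=> s; split.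
    move=> [[ps sm]|[t [[pt dt] /= tm] <-]].
      by split=> //; apply: sub_all sm => x; lia.
    split; last by rewrite /= leqnn.
    split; last by rewrite /parts_divisible_by /= dvdn_mulr.
    by rewrite is_partition_cons pt andbT muln_gt0 /=.
  case: s => [|x s] [[ps ds] sm]; first by left.
  move: ps ds sm; rewrite is_partition_cons => /and3P[x0 xs ps].
  rewrite /parts_divisible_by /= => /andP[dx ds] /andP[xm sm].
  have [xe|xne] := eqVneq x (4 * m.+1)%N.
    by right; exists s; [split|rewrite xe].
  have xlt : (x <= 4 * m)%N by move/dvdnP: dx => [k kx]; lia.
  left; split; last by rewrite /= xlt; apply: sub_all xs => y /=; lia.
  split; first by rewrite is_partition_cons x0 xs.
  by rewrite /parts_divisible_by /= dx.
have hprod m : h m * \prod_(i < m) qterm (-1) 4 4 i = 1.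
  elim: m => [|m IH]; first by rewrite big_ord0 h0 mulr1.
  rewrite big_ord_recr /=; set P := \prod_(i < m) _ in IH *.
  rewrite -[RHS]IH.
  have -> : h m = h m.+1 - q ^+ (4 * m.+1) * h m.+1 by rewrite {1}hS addrK.
  by rewrite /qterm (_ : 4 * m + 4 = 4 * m.+1)%N; [ring|lia].
have hg : slim h g.
  move=> n; exists n => m nm i lin; apply: counted_eq (hE m) cg _ => s si.
  split=> [[]|ps] //; split=> //; apply/allP => x /leq_sumn /=; lia.
apply: slim_unique (slimM hg (slim_qfac (-1) (isT : 0 < 4)%N (isT : 0 < 4)%N)) _.
by apply: slim_ext (slim_cst 1) => m; rewrite hprod.
Qed.

Definition Bser : series R := Series (fun n => (nb_triples n)%:R).

Lemma Bser_euler : Bser * euler R 4 = oddfac R ^+ 2.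
Proof.
have [g cg] : exists g, counted partitions4 sumn g.
  by apply: counted_partitions => s [].
have := counted_prod (counted_prod counted_odd counted_odd) cg => ct.
suff -> : Bser = oddfac R * oddfac R * g by rewrite -mulrA counted_4 // mulr1.
apply: seriesP => n; have [s [us sA ->]] := ct n.
congr (_%:R); apply: card_fset_set (finite_partition_triples n) => //.
move=> [[s1 s2] s3]; split=> [/sA[[[[? ?] [? ?]] [? ?]] e]|].
  by split=> //; apply/and3P.
move=> [/and3P[? ? ?] ? ? ? ?]; apply/sA; split=> //.
Qed.

Lemma Bser_psi : Bser * euler R 4 ^+ 3 = psi R ^+ 2.
Proof.
rewrite psi_oddfac exprMn -Bser_euler; ring.
Qed.

Lemma Bser_mod9 : 9%:R = 0 :> R ->
  Bser * euler R 12 = psi R ^+ 2 * (1 + 3%:R * sdil 4 (Sumdiv R)).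
Proof.
move=> h9; have -> : euler R 12 = sdil 4 (euler R 3) by rewrite sdil_euler.
rewrite euler3_mod9 // rmorphM rmorphXn rmorphD rmorph1 rmorphM rmorph_nat /=.
by rewrite sdil_euler // mulrA Bser_psi.
Qed.

End Counting.

(** * The congruence modulo 9 *)

Definition smap (R T : Type) (phi : R -> T) (g : series R) : series T :=
  Series (fun n => phi (g n)).

Lemma smapM (R T : comNzRingType) (phi : {rmorphism R -> T}) (g h : series R) :
  smap phi (g * h) = smap phi g * smap phi h.
Proof.
apply: seriesP => n; rewrite [LHS]rmorph_sum scoefM.
by apply: eq_bigr => i _; rewrite rmorphM.
Qed.

(** The same integer is to be read modulo 3 and modulo 9. *)
Lemma psi_sq_Sumdiv4_int (R : comNzRingType) n :
  (psi R ^+ 2 * sdil 4 (Sumdiv R)) n =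
  ((psi int ^+ 2 * sdil 4 (Sumdiv int)) n)%:~R.
Proof.
have psiR : psi R = smap intr (psi int).
  by apply: seriesP => i /=; rewrite rmorph_nat.
have sigR : sdil 4 (Sumdiv R) = smap intr (sdil 4 (Sumdiv int)).
  apply: seriesP => i /=; case: ifP => _; last by rewrite mulr0z.
  by rewrite rmorph_nat.
by rewrite psiR sigR !expr2 -!smapM.
Qed.

Lemma intr_Zp m (z : int) : (1 < m)%N -> z%:~R = 0 :> 'Z_m -> (m %| z)%Z.
Proof.
move=> m1; rewrite {1}(divz_eq z m) rmorphD rmorphM /=.
rewrite -[X in _ * X + _]/(m%:R) pchar_Zp // mulr0 add0r => z0.
apply/dvdz_mod0P; move: z0.
have : (z %% m)%Z = (absz (z %% m)%Z)%:Z by rewrite gez0_abs // modz_ge0 //; lia.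
have : (z %% m < m)%Z by rewrite ltz_pmod //; lia.
move: (z %% m)%Z (absz _) => u v ult uv; rewrite uv in ult *.
rewrite -[_%:~R]/(v%:R) => /(congr1 val) /=; rewrite val_Zp_nat // modn_small.
  by move=> ->.
lia.
Qed.

(** -1 is not a square modulo p, because (p - 1)/2 is odd. *)
Lemma dvdn_sum_squares p x y : prime p -> p = 3 %[mod 4] ->
  (p %| x * x + y * y)%N -> (p %| x)%N.
Proof.
move=> pp p4 pxy; apply/negPn/negP => px.
have F (k : nat) : (p %| k)%N = (k%:R == 0 :> 'F_p).
  by rewrite -(dvdn_pcharf (pchar_Fp pp)).
set a : 'F_p := x%:R; set b : 'F_p := y%:R.
have a0 : a != 0 by rewrite -F.
have ab : b ^+ 2 = - a ^+ 2.
  apply/eqP; rewrite -addr_eq0 addrC; move: pxy; rewrite F natrD !natrM.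
  by rewrite !expr2.
have fa (n : nat) : n%:R != 0 :> 'F_p -> n%:R ^+ p.-1 = 1 :> 'F_p.
  move=> c0; apply: (mulfI c0); rewrite -exprS prednK ?prime_gt0 // mulr1.
  by rewrite -natrX -[(n ^ p)%:R](Fp_nat_mod pp) fermat_little // Fp_nat_mod.
have b0 : b != 0.
  by apply: contraNneq a0 => b0; move/eqP: ab; rewrite b0 expr0n /= eq_sym oppr_eq0 expf_eq0.
have [k pk] : exists k, p.-1 = (2 * (2 * k + 1))%N.
  by exists (p %/ 4)%N; have := divn_eq p 4; rewrite p4; have := prime_gt0 pp; lia.
have := fa _ b0; rewrite pk exprM ab exprNn -exprM -pk fa // mulr1.
rewrite exprD exprM sqrrN !expr1n expr1 mul1r => /eqP.
rewrite eq_sym -addr_eq0 -(natrD _ 1 1) -F => /dvdn_leq p2.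
by have := prime_gt1 pp; have := p4; have := p2 isT; case: (p) => [|[|[|]]].
Qed.

(** A term of the convolution that does not vanish writes 2(4N + 1) as a sum of two
    squares x^2 + y^2; then p divides x and y, and p^2 divides 4N + 1. *)
Lemma psi_sq_coef0 (R : comNzRingType) p N : prime p -> p = 3 %[mod 4] ->
    (p %| 4 * N + 1)%N -> ~~ (p * p %| 4 * N + 1)%N ->
  (psi R ^+ 2) N = 0.
Proof.
move=> pp p4 pN ppN; rewrite expr2 scoefM big1 // => i _ /=.
case: is_squareP => [[x xx]|_]; last by rewrite mul0r.
case: is_squareP => [[y yy]|_]; last by rewrite mulr0.
have iN : (i <= N)%N by rewrite -ltnS.
have xy : (x * x + y * y = 2 * (4 * N + 1))%N by lia.
have pxy : (p %| x * x + y * y)%N by rewrite xy dvdn_mull.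
have px := dvdn_sum_squares pp p4 pxy.
have py : (p %| y)%N by apply: (dvdn_sum_squares pp p4 (y := x)); rewrite addnC.
case/negP: ppN; rewrite -(@Gauss_dvdr _ 2).
  by rewrite -xy dvdn_add // dvdn_mul.
rewrite coprimeMl andbb coprimen2.
by move: p4; clear; lia.
Qed.

Lemma theta_term_sign (T : comNzRingType) (u v : T) k :
  theta_term (-1 * u) (-1 * v) k = (-1) ^+ absz k * theta_term u v k.
Proof.
rewrite /theta_term !exprMn mulrACA -exprD tri_sum; congr (_ * _).
by rewrite -[LHS]signr_odd oddM andbb signr_odd.
Qed.

Lemma theta_term_pow (T : comNzRingType) (x : T) a b k :
  theta_term (x ^+ a) (x ^+ b) k = x ^+ (a * tri k + b * tri (k - 1)%R).
Proof. by rewrite /theta_term exprD !exprM. Qed.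

(** Only finitely many k contribute, and modulo q^(N+1) the series f_12 is a finite
    theta sum. *)
Lemma sum_B (R : comNzRingType) (N : nat) :
  (\sum_(k \in [set: int]) (-1) ^ k * B (N%:Z - 6 * k * (3 * k + 1)))%:~R =
  (Bser R * euler R 12) N.
Proof.
have [m0 h] := pentagonal12 R N.+1; pose m := maxn m0 N.
have mN : (N <= m)%N by rewrite leq_maxr.
have -> : (Bser R * euler R 12) N = (Bser R * \sum_(j < (2 * m).+1)
   theta_term (-1 * qvar R ^+ 24) (-1 * qvar R ^+ 12) (j%:Z - m%:Z)) N.
  apply/esym/(@eqmodM _ N.+1) => //; exact/h/leq_maxl.
rewrite (fsbigE [seq j%:Z - m%:Z | j <- iota 0 (2 * m).+1]) //; last 2 first.
- by rewrite map_inj_uniq ?iota_uniq // => i j /addIr [].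
- move=> k _ kr; have km : (m < absz k)%N.
    rewrite ltnNge; apply/negP => km; case/negP: kr; apply/mapP.
    exists (absz (k + m%:Z)); first by rewrite mem_iota; lia.
    lia.
  have : N%:Z - 6 * k * (3 * k + 1) < 0 by nia.
  by case: (_ - _) => // n _; rewrite mulr0.
under eq_bigl => k do rewrite in_setT.
rewrite big_map -[iota _ _]/(index_iota 0 (2 * m).+1) big_mkord rmorph_sum.
rewrite mulr_sumr scoef_sum; apply: eq_bigr => j _.
set k : int := j%:Z - m%:Z.
rewrite theta_term_sign theta_term_pow [LHS]rmorphM [LHS]/=.
set e := (24 * _ + _)%N.
have eE : e%:Z = 6 * k * (3 * k + 1).
  have := tri_double k; have := tri_double (k - 1); rewrite subrK /e.
  by move: (tri _) (tri _) => u v; clear; nia.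
have -> : (B (N%:Z - 6 * k * (3 * k + 1)))%:~R = (qvar R ^+ e * Bser R) N.
  rewrite scoef_qvarXM -eE; case: leqP => [eN|Ne].
    by rewrite subzn.
  have : N%:Z - e%:Z < 0 by rewrite subr_lt0 ltz_nat.
  by case: (_ - _).
rewrite mulrCA [Bser R * _]mulrC expN1r rmorphXn rmorphN1.
rewrite -[in LHS]signr_odd -[in RHS]signr_odd.
by case: (odd _); rewrite ?expr0 ?mul1r // !expr1 !mulN1r scoefN.
Qed.

Theorem theorem1p5 (p : nat) (hp : prime p)
    (hp12 : p = 7 %[mod 12] \/ p = 11 %[mod 12])
    (n r : nat) (hr : (1 <= r <= p - 1)%N) :
  ((\sum_(k \in [set: int])
      (-1) ^ k *
      B ((3 * p ^ 2 * n + 3 * p * r + 5 * (p ^ 2 - 1) %/ 4 + 1)%N%:Z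
         - 6 * k * (3 * k + 1)))
   = 0 %[mod 9])%Z.
Proof.
set N := (_ + 1)%N.
have p4 : p = 3 %[mod 4] by lia.
have p5 : (5 < p)%N by lia.
have [t pt] : exists t : nat, (p ^ 2 = 24 * t + 1)%N.
  have := divn_eq p 12; move: (p %/ 12)%N => a pa.
  case: hp12 => pm; rewrite pm in pa; rewrite -mulnn pa.
    by exists (6 * a * a + 7 * a + 2)%N; rewrite -[(7 %% 12)%N]/7%N; ring.
  by exists (6 * a * a + 11 * a + 5)%N; rewrite -[(11 %% 12)%N]/11%N; ring.
pose M := (p ^ 2 * n + p * r + 10 * t)%N.
have NE : N = (3 * M + 1)%N.
  have -> : N = (3 * p ^ 2 * n + 3 * p * r + 30 * t + 1)%N.
    rewrite /N; congr (_ + _ + _)%N; rewrite pt addnK.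
    by rewrite (_ : 5 * (24 * t) = 30 * t * 4)%N ?mulnK //; ring.
  by rewrite /M; ring.
have N4 : (4 * N + 1 = p * (12 * p * n + 12 * r + 5 * p))%N.
  have -> : (p * (12 * p * n + 12 * r + 5 * p) =
      12 * (p ^ 2 * n + p * r) + 5 * p ^ 2)%N by rewrite -mulnn; ring.
  rewrite NE /M; move: pt (p ^ 2 * n)%N (p * r)%N; move: (p ^ 2)%N; clear; lia.
(* p divides 4N + 1 exactly once *)
have psi0 R : (psi R ^+ 2) N = 0.
  apply: (@psi_sq_coef0 R p) => //; first by rewrite N4 dvdn_mulr.
  rewrite N4 dvdn_pmul2l ?prime_gt0 //.
  rewrite dvdn_addl ?dvdn_mull // dvdn_addr; last by rewrite -mulnA mulnCA dvdn_mulr.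
  rewrite Euclid_dvdM // negb_or; apply/andP; split; apply/negP => dv.
    have p12 : (p <= 12)%N by exact: dvdn_leq.
    have [pe|pe] : (p = 7 \/ p = 11)%N by lia.
      by rewrite pe in dv.
    by rewrite pe in dv.
  by have := dvdn_leq _ dv; lia.
apply/eqP; rewrite eqz_mod_dvd subr0; apply: (@intr_Zp 9) => //.
rewrite sum_B Bser_mod9 ?pchar_Zp //.
rewrite mulrDr mulr1 scoefD psi0 add0r mulrCA scoefMnat.
rewrite psi_sq_Sumdiv4_int; set z := (_ * _ : series int) N.
have /dvdzP[u ->] : (3 %| z)%Z.
  apply: (@intr_Zp 3) => //; rewrite -psi_sq_Sumdiv4_int.
  have h3 : 3%:R = 0 :> 'Z_3 by rewrite pchar_Zp.
  have := psi_sq_Sumdiv4 h3 M; rewrite -NE psi0 mulr0.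
  set x := scoef _ _ => z2.
  transitivity (3%:R * x - 2%:R * x); first by ring.
  by rewrite h3 z2 mul0r subr0.
have h33 : 3%:R * 3%:R = 0 :> 'Z_9 by rewrite -natrM; exact: (@pchar_Zp 9).
by rewrite rmorphM mulrCA -[X in _ * (_ * X)]/(3%:R) h33 mulr0.
Qed.
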